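(* For a random bipartite matching problem with i.i.d. edge costs (RBMP-I), given $n,m\in\mathbb{Z}^+$ with $m\le n$, and edge-cost distribution $F_C(x)=\left(\frac{x}{R}\right)^D$, $x\in[0,R]$, where $R>0$ and $D\in\mathbb{Z}^+$: when $n\gg m$, the expected greedy, refined, optimal and nearest matching costs converge, $$\mathbb{E}[\bar C(m,n)]\xrightarrow{n\gg m}\mathbb{E}[\hat C(m,n)]\xrightarrow{n\gg m}\mathbb{E}[\overset{\ast}{C}(m,n)]\xrightarrow{n\gg m}\mathbb{E}[\bar C(1,n)]=R\cdot\Gamma\left(1+\tfrac1D\right)\cdot n^{-\frac1D}.$$
   Context: The arrow $\xrightarrow{n\gg m}$ is informal notation: the quantity on the left converges to the quantity on the right when $n$ is much larger than $m$. The closed form for $\mathbb{E}[\bar C(1,n)]$ is written with the large-$n$ replacement $\Gamma(n+1)/\Gamma(n+1+\frac1D)\approx n^{-1/D}$. RBMP-I: $U=\{1,\dots,m\}$ (demand vertices) and $V=\{1,\dots,n\}$ (supply vertices), $m\le n$; the edge costs $c_{u,v}$, $(u,v)\in U\times V$, are i.i.d. with CDF $F_C$ (density $f_C$). Every demand vertex is matched to exactly one supply vertex, and distinct demand vertices to distinct supply vertices. The $k$-th nearest neighbor of $u\in U$ is the supply vertex with the $k$-th smallest cost from $u$. $\mathbb{E}[C\mid k]$ is the expected cost from a demand vertex to its $k$-th nearest neighbor, i.e. the mean of the $k$-th order statistic of $n$ i.i.d. samples from $F_C$. Optimal cost $\overset{\ast}{C}(m,n)$: the cost of a randomly sampled $u\in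 U$ to its match in a matching minimizing the total cost. Greedy cost $\bar C(m,n)$: demand vertices are selected one by one in random order, each being matched to its nearest supply vertex not previously matched; $\bar C(m,n)$ is the matching cost of a randomly sampled demand vertex. Its expectation is $\mathbb{E}[\bar C(m,n)]=\sum_{k=1}^m\mathbb{E}[C\mid k]\,\bar{\mathbb{P}}(k)$ with $\bar{\mathbb{P}}(k)=\frac1m\sum_{i=k}^m\binom{n-k}{i-k}/\binom{n}{i-1}$. The nearest matching cost is $\bar C(1,n)$ (the case $m=1$). Refined cost $\hat C(m,n)$: it models an improvement of the greedy solution in which a demand vertex $u$ (the $i$-th in the greedy order, greedily matched to its $k'$-th nearest neighbor) checks its nearer neighbors in ascending order of cost and moves to the first one, say its $k''$-th nearest neighbor, for which a two-vertex swap is feasible: the demand vertex $u'$ holding that supply vertex (as its $q''$-th nearest neighbor) moves to its $q'$-th nearest neighbor, $q''<q'\le m$, being the next one that is matched to $u$ or unmatched, and the cost increase of $u'$ does not exceed the cost reduction of $u$. Feasibilities of different swaps are treated as independent. The expectation is given by $\mathbb{E}[\hat C(m,n)]=\sum_{k=1}^m\mathbb{E}[C\mid k]\,\hat{\mathbb{P}}(k)$, where $$\hat{\mathbb{P}}(k)=\frac1m\sum_{i=k}^m\sum_{k'=k}^i\frac{\binom{n-k'}{i-k'}}{\binom{n}{i-1}}\,s(k',k\mid i)\prod_{k''=1}^{k-1}\left[1-s(k',k''\mid i)\right],$$ $s(k',k'\mid i)=1$, and for $1\le k''<k'\le i$ $$s(k',k''\mid i)=\frac1{i-1}\sum_{q''=1}^{i-1}\sum_{q'=q''+1}^{m}\frac{\binom{n-q'}{m-q'}}{\binom{n-q''}{m-q''-1}}\Pr\{\Delta_{q'',q'}\le\Delta_{k'',k'}\},$$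 $$\Pr\{\Delta_{q'',q'}\le\Delta_{k'',k'}\}=\int_0^\infty\left[\int_0^y f_{\Delta_{q'',q'}}(x)\,dx\right]f_{\Delta_{k'',k'}}(y)\,dy,$$ where $f_{\Delta_{i,j}}$ ($i<j$) is the density of the spacing between the $j$-th and $i$-th order statistics of $n$ i.i.d. samples from $F_C$. *)

(* Defs.v *)
From HB Require Import structures.
From mathcomp Require Import all_boot all_order all_algebra all_fingroup.
From mathcomp Require Import all_classical all_reals all_analysis.

Set Implicit Arguments.
Unset Strict Implicit.
Unset Printing Implicit Defensive.

Import Order.TTheory GRing.Theory Num.Theory.
Import numFieldNormedType.Exports.

Local Open Scope classical_set_scope.
Local Open Scope ring_scope.

Definition Gamma (R : realType) (s : R) : R :=
  \int[lebesgue_measure]_(t in `]0, +oo[%classic) (t `^ (s - 1) * expR (- t)).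

(* The CDF (x / r) ^ D on [0, r], extended to the whole line. *)
Definition power_cdf (R : realType) (r : R) (D : nat) (x : R) : R :=
  if x < 0 then 0 else if x <= r then (x / r) ^+ D else 1.

Definition mutually_independent (R : realType) (d : measure_display)
    (T : measurableType d) (P : probability T R) (J : finType)
    (X : J -> {RV P >-> R}) : Prop :=
  forall (S : {set J}) (A : J -> set R), (forall j, measurable (A j)) ->
    P [set w | forall j, j \in S -> A j (X j w)] =
      (\prod_(j in S) P (X j @^-1` A j))%E.

(* A bipartite matching problem with demand vertices 'I_m, supply vertices
   'I_n, and i.i.d. edge costs with CDF F. The constraint m <= n is not part of
   the record, so that one can speak of a family indexed by all (m, n). *)
Record rbmp (R : realType) (F : R -> R) (m n : nat) := RBMP {
  rbmp_disp : measure_display;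
  rbmp_space : measurableType rbmp_disp;
  rbmp_prob : probability rbmp_space R;
  rbmp_cost : 'I_m * 'I_n -> {RV rbmp_prob >-> R};
  rbmp_cdf : forall e x, cdf (rbmp_cost e) x = (F x)%:E;
  rbmp_indep : mutually_independent rbmp_cost }.

Definition edge_costs (R : realType) (F : R -> R) (m n : nat)
    (I : rbmp F m n) (w : rbmp_space I) : 'I_m -> 'I_n -> R :=
  fun u v => rbmp_cost I (u, v) w.

Definition mean (R : realType) (F : R -> R) (m n : nat) (I : rbmp F m n)
    (X : ('I_m -> 'I_n -> R) -> R) : R :=
  fine ('E_(rbmp_prob I)[fun w => X (edge_costs w)])%E.

Section Matching.
Variables (R : realType) (m n : nat).
Implicit Types c : 'I_m -> 'I_n -> R.

(* Cost from u to its k-th nearest neighbor, with k counted from 1. *)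
Definition neighbor_cost c (u : 'I_m) (k : nat) : R :=
  nth 0 (sort <=%R [seq c u v | v <- enum 'I_n]) k.-1.

Definition spacing c (u : 'I_m) (i j : nat) : R :=
  neighbor_cost c u j - neighbor_cost c u i.

Definition total_cost c (s : {ffun 'I_m -> 'I_n}) : R := \sum_u c u (s u).

Definition is_optimal c (s : {ffun 'I_m -> 'I_n}) : bool :=
  injectiveb s &&
  [forall t : {ffun 'I_m -> 'I_n},
     injectiveb t ==> (total_cost c s <= total_cost c t)].

(* Averaged over the uniformly sampled demand vertex; the default value is used
   only when m > n, i.e. when there is no matching. *)
Definition optimal_cost c : R :=
  if [pick s | is_optimal c s] is Some s then total_cost c s / m%:R else 0.

Definition nearest_free c (u : 'I_m) (A : {set 'I_n}) : option 'I_n :=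
  [pick v in ~: A | [forall v' in ~: A, c u v <= c u v']].

(* The demand vertices of s are processed from left to right; A is the set of
   supply vertices that are already matched. *)
Fixpoint greedy_matching c (s : seq 'I_m) (A : {set 'I_n}) :
    seq ('I_m * 'I_n) :=
  if s is u :: s' then
    if nearest_free c u A is Some v then
      (u, v) :: greedy_matching c s' (v |: A)
    else [::]
  else [::].

(* Averaged over the uniformly random order and the uniformly sampled demand
   vertex. *)
Definition greedy_cost c : R :=
  (m`!)%:R^-1 * \sum_(pi : 'S_m)
    (\sum_(e <- greedy_matching c [seq pi u | u <- enum 'I_m] finset.set0)
       c e.1 e.2) / m%:R.

Definition sampled_neighbor_cost c (k : nat) : R :=
  (\sum_u neighbor_cost c u k) / m%:R.

End Matching.

Definition is_density (R : realType) (d : measure_display)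
    (T : measurableType d) (P : probability T R) (X : T -> R) (f : R -> R) :
    Prop :=
  [/\ measurable_fun setT f, (forall x, 0 <= f x)
    & forall A : set R, measurable A ->
        P (X @^-1` A) = (\int[lebesgue_measure]_(x in A) (f x)%:E)%E].

(* The probability that a variable with density f is at most an independent one
   with density g, both being nonnegative. *)
Definition prob_le (R : realType) (f g : R -> R) : R :=
  \int[lebesgue_measure]_(y in `[0, +oo[%classic)
    ((\int[lebesgue_measure]_(x in `[0, y]%classic) f x) * g y).

Section Refined.
Variables (R : realType) (m n : nat).
(* f i j is the density of the spacing between the order statistics i < j. *)
Variable f : nat -> nat -> R -> R.

Definition swap_prob (k' k'' i : nat) : R :=
  if k'' == k' then 1 else
  (i.-1)%:R^-1 *
  \sum_(1 <= q'' < i) \sum_(q''.+1 <= q' < m.+1)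
    'C(n - q', m - q')%:R / 'C(n - q'', m - q'' - 1)%:R
      * prob_le (f q'' q') (f k'' k').

Definition refined_prob (k : nat) : R :=
  m%:R^-1 *
  \sum_(k <= i < m.+1) \sum_(k <= k' < i.+1)
    'C(n - k', i - k')%:R / 'C(n, i - 1)%:R
      * swap_prob k' k i
      * \prod_(1 <= k'' < k) (1 - swap_prob k' k'' i).

End Refined.

Section ExpectedCosts.
Variables (R : realType) (F : R -> R) (m n : nat) (I : rbmp F m n).

Definition mean_greedy : R := mean I (@greedy_cost R m n).

Definition mean_optimal : R := mean I (@optimal_cost R m n).

Definition mean_neighbor (k : nat) : R :=
  mean I (fun c => sampled_neighbor_cost c k).

Definition mean_refined (f : nat -> nat -> R -> R) : R :=
  \sum_(1 <= k < m.+1) mean_neighbor k * refined_prob m n f k.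

End ExpectedCosts.

(* The regime n >> m over pairs (m, n): m >= 1 and n / m -> oo, with m free to
   stay bounded or to grow. *)
Definition much_greater : set_system (nat * nat) :=
  filter_from setT
    (fun K : nat => [set p : nat * nat | (0 < p.1)%N /\ (K * p.1 <= p.2)%N]).

#[global] Instance much_greater_proper : ProperFilter much_greater.
Proof.
apply: filter_from_proper => [|K _]; last first.
  by exists (1, K)%N => /=; rewrite muln1.
apply: filter_from_filter; first by exists 0%N.
move=> K L _ _; exists (maxn K L) => // -[a b] /= [a0 ab].
by split; split => //; apply: leq_trans ab; rewrite leq_mul2r ?leq_maxl ?leq_maxr orbT.
Qed.

(* Main.v *)
From HB Require Import structures.
Require Import Defs.
From mathcomp Require Import all_boot all_order all_algebra all_fingroup.
From mathcomp Require Import all_classical all_reals all_analysis.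
From mathcomp Require Import measurable_realfun.
From mathcomp Require Import ring lra zify.

(** Let mu n be the mean of the smallest of n independent costs; it is the
    nearest matching cost. The proof squeezes the optimal, refined and greedy
    costs between mu n and mu (n - m + 1), and these two bounds are equivalent
    when n is much larger than m.

    The value of mu. Integrating the tail (1 - (x / r) ^ D) ^ n over [0, r]
    gives mu n = r * \prod_(1 <= k <= n) k / (k + 1/D) ([integral_tail_pow]).
    The functional equation of Gamma turns the product into the quotient of the
    closed form ([expected_min_Gamma]), and Wendel's inequality
    Gamma (x + a) <= x ^ a * Gamma x gives its decay n ^ (- 1/D)
    ([cvg_expected_min]). Since (k + 1/D) / k <= (k + 1) / k, the product also
    yields the telescoping bound mu N <= (n + 1) / (N + 1) * mu n for N <= n
    ([expected_min_shift]), so that mu (n - m + 1) / mu n tends to 1.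

    Greedy cost. The supply vertices taken before the i-th step depend on the
    rows of costs of earlier demand vertices only, and are therefore independent
    of the current row. The i-th step thus pays the minimum of n - i + 1 fresh
    costs, and the mean greedy cost is the average of mu (n - i + 1) over
    1 <= i <= m ([mean_greedyE]). Independence is needed for events such as
    a given greedy history, which are not rectangles in the costs; it is extended
    to them by the pi-lambda theorem ([row_sigma_indep]).

    Optimal cost. Every demand vertex pays at least its row minimum, of mean
    mu n, and an optimal matching is at most as expensive as a greedy one.

    Refined cost. Let w k be the weight 'C(n - k, i - k) / 'C(n, i - 1) with
    which the i-th greedy step uses the k-th nearest neighbor. For any row,
    summing w k times its k-th smallest cost averages the minimum over the
    complements of the sets of i - 1 taken vertices ([sum_free_cost]), so the
    w-average of the mean neighbor costs is mu (n - i + 1)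
    ([sum_mean_neighbor]). The swap probabilities lie in [0, 1]
    ([swap_prob_bounds]), hence for each initial rank the rank after the swap
    follows a genuine distribution on the ranks that are not larger. As mean
    neighbor costs increase with the rank, the refined cost lies between the
    mean first neighbor cost, which is mu n, and the greedy cost. *)

Set Implicit Arguments.
Unset Strict Implicit.
Unset Printing Implicit Defensive.

Import Order.TTheory GRing.Theory Num.Theory.
Import numFieldNormedType.Exports.

Local Open Scope classical_set_scope.
Local Open Scope ring_scope.

(** * The mean of a minimum of independent costs *)
Section TailMoment.
Variables (R : realType).

(** Mean of the minimum of N independent costs with CDF (x / r) ^ D, in the
    product form that the tail integral yields. *)
Definition expected_min (r : R) (D N : nat) : R :=
  r * \prod_(1 <= k < N.+1) (k%:R / (k%:R + D%:R^-1)).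

(** An antiderivative of (1 - (x / r) ^ D) ^ N, vanishing at 0. The recursion
    comes from differentiating x * (1 - (x / r) ^ D) ^ N, which is
    (N * D + 1) * (1 - (x / r) ^ D) ^ N - N * D * (1 - (x / r) ^ D) ^ (N - 1). *)
Fixpoint tail_primitive (r : R) (D N : nat) : {poly R} :=
  if N is N'.+1 then
    (N%:R * D%:R + 1)^-1 *: ('X * (1 - (r^-1 *: 'X) ^+ D) ^+ N
       + (N%:R * D%:R) *: tail_primitive r D N')
  else 'X.

Lemma deriv_tail_primitive (r : R) (D N : nat) : (0 < D)%N ->
  (tail_primitive r D N)^`() = (1 - (r^-1 *: 'X) ^+ D) ^+ N.
Proof.
case: D => // D _; elim: N => [|N IH] /=; first by rewrite derivX expr0.
have c0 : N.+1%:R * D.+1%:R + 1 != 0 :> R.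
  by rewrite gt_eqF // ltr_wpDl // mulr_ge0.
rewrite derivZ derivD derivM derivX mul1r derivZ IH.
rewrite deriv_exp derivB deriv_exp derivZ derivX derivC /=.
apply: (scalerI c0); rewrite scalerA divff // scale1r.
rewrite -!mul_polyC polyCD polyCM !polyC_natr sub0r mulr1.
rewrite -[_ *+ D.+1]mulr_natr -[_ *+ N.+1]mulr_natr (exprS _ D) (exprS _ N).
rewrite polyC1; set Y := (_ * 'X) ^+ D; set Q := (1 - _ * Y) ^+ N.
set a := N.+1%:R; set b := D.+1%:R; ring.
Qed.

Lemma horner_tail_primitive0 (r : R) (D N : nat) : (tail_primitive r D N).[0] = 0.
Proof.
elim: N => [|N IH] /=; first by rewrite hornerX.
by rewrite hornerZ hornerD hornerM hornerX mul0r hornerZ IH mulr0 addr0 mulr0.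
Qed.

Lemma horner_tail_primitive_r (r : R) (D N : nat) : r != 0 -> (0 < D)%N ->
  (tail_primitive r D N).[r] = expected_min r D N.
Proof.
move=> r0 D0; rewrite /expected_min; elim: N => [|N IH] /=.
  by rewrite hornerX big_geq// mulr1.
rewrite hornerZ hornerD hornerM hornerX hornerZ IH.
rewrite !(hornerE, horner_exp) mulVf // expr1n subrr expr0n /= mulr0 add0r.
rewrite [in RHS]big_nat_recr //=; set P := \prod_(_ <= _ < _) _.
have D0' : D%:R != 0 :> R by rewrite pnatr_eq0 -lt0n.
have h : N.+1%:R * D%:R + 1 != 0 :> R by rewrite gt_eqF // ltr_wpDl // mulr_ge0.
by field; rewrite D0' /=; move: h; rewrite -natr1 [1 + _]addrC.
Qed.

Lemma expected_min_gt0 (r : R) (D N : nat) : 0 < r -> 0 < expected_min r D N.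
Proof.
move=> r0; rewrite mulr_gt0 // big_nat prodr_gt0 // => k /andP[k1 _].
by rewrite divr_gt0 ?ltr0n // ltr_wpDr ?invr_ge0 // ltr0n.
Qed.

(** The tail formula for the mean of a nonnegative variable, applied to a minimum
    of N costs. For N = 0 the integral would diverge. *)
Lemma integral_tail_pow (r : R) (D N : nat) : 0 < r -> (0 < D)%N -> (0 < N)%N ->
  (\int[lebesgue_measure]_(x in `[0%R, +oo[) ((1 - power_cdf r D x) ^+ N)%:E
   = (expected_min r D N)%:E)%E.
Proof.
move=> r0 D0 N0.
have -> : (\int[lebesgue_measure]_(x in `[0%R, +oo[) ((1 - power_cdf r D x) ^+ N)%:E
    = \int[lebesgue_measure]_(x in `[0%R, r])
        (((1 - (r^-1 *: 'X) ^+ D) ^+ N : {poly R}).[x])%:E)%E.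
  rewrite integral_mkcond [RHS]integral_mkcond; apply: eq_integral => x _.
  rewrite !patchE !mem_setE !in_itv /= andbT.
  have [x0|//] := leP 0 x; rewrite /power_cdf ltNge x0 /=.
  have [xr|rx] := leP x r; last by rewrite subrr expr0n gtn_eqF.
  by rewrite !(hornerE, horner_exp) [r^-1 * x]mulrC.
rewrite (@continuous_FTC2 _ _ (horner (tail_primitive r D N))) //.
- by rewrite horner_tail_primitive0 horner_tail_primitive_r ?gt_eqF // sube0.
- by apply: continuous_subspaceT; exact: continuous_horner.
- split=> [x _||].
  + exact: derivable_horner.
  + by apply: cvg_at_right_filter; exact: continuous_horner.
  + by apply: cvg_at_left_filter; exact: continuous_horner.
- by move=> x _; rewrite -deriv_tail_primitive // -derivE.
Qed.

End TailMoment.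

(** * The Gamma function at arguments at least 1 *)
Section GammaFunction.
Variable R : realType.
Local Notation mu := (@lebesgue_measure R).

Definition gamma_fun (s t : R) : R := t `^ (s - 1) * expR (- t).

Lemma gamma_fun_ge0 (s t : R) : 0 <= gamma_fun s t.
Proof. by rewrite mulr_ge0 ?powR_ge0 ?expR_ge0. Qed.

Lemma measurable_gamma_fun (s : R) : measurable_fun setT (gamma_fun s).
Proof.
apply: measurable_funM; first exact: measurable_powR.
by apply: measurableT_comp => //; apply: measurableT_comp.
Qed.

(** A power is dominated by exp (t / 2); this gives both the integrability of the
    integrand and its limit at infinity. *)
Lemma gamma_fun_bound (s : R) : 1 <= s ->
  exists2 C, 0 < C & forall t, 0 <= t -> gamma_fun s t <= C * expR (- 2^-1 * t).
Proof.
move=> s1; pose n := Num.truncn s; have sn : s - 1 <= n.+1%:R.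
  by apply: le_trans (ltW (truncnS_gt s)); rewrite lerBlDr lerDl.
(* From (t / 2) ^ (n + 1) / (n + 1)! <= exp (t / 2). *)
pose K : R := (n.+1)`!%:R * 2 ^+ n.+1.
have K0 : 0 < K by rewrite mulr_gt0 ?exprn_gt0 // ltr0n fact_gt0.
exists (1 + K); first by rewrite addr_gt0.
move=> t t0.
have tn : t `^ (s - 1) <= 1 + t ^+ n.+1.
  have [t1|t1] := leP t 1.
    rewrite (@le_trans _ _ 1) // ?lerDl ?exprn_ge0 //.
    rewrite (le_trans (ge0_ler_powR _ _ _ t1)) ?nnegrE ?subr_ge0 //.
    by rewrite powR1.
  rewrite (@le_trans _ _ (t ^+ n.+1)) // ?lerDr //.
  by rewrite -powR_mulrn // ler_powR // ltW.
have te : t ^+ n.+1 <= K * expR (2^-1 * t).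
  have t20 : 0 <= 2^-1 * t by rewrite mulr_ge0 // invr_ge0.
  have := expR_ge1Dxn n t20.
  rewrite exprMn exprVn => h.
  have F0 : 0 < (n.+1)`!%:R :> R by rewrite ltr0n fact_gt0.
  have P0 : 0 < 2 ^+ n.+1 :> R by rewrite exprn_gt0.
  rewrite /K -ler_pdivrMl ?mulr_gt0 // (le_trans _ h) //.
  rewrite (_ : _^-1 * _ = 2 ^- n.+1 * t ^+ n.+1 / (n.+1)`!%:R) ?lerDr //.
  move: F0 P0; set a : R := _`!%:R; set b := 2 ^+ _; set c := t ^+ _ => a0 b0.
  by field; rewrite !gt_eqF.
have e1 : 1 <= expR (2^-1 * t).
  by rewrite -expR0 ler_expR mulr_ge0 ?invr_ge0.
rewrite /gamma_fun (_ : - t = - 2^-1 * t + - (2^-1 * t)); last by field.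
rewrite expRD [expR (- (_ * _))]expRN mulrCA mulrA [leRHS]mulrC -mulrA.
rewrite ler_wpM2l ?expR_ge0 // ler_pdivrMr ?expR_gt0 //.
by rewrite (le_trans tn) // mulrDl mul1r lerD.
Qed.

Lemma integrable_gamma_fun (s : R) : 1 <= s ->
  mu.-integrable `[0, +oo[ (EFin \o gamma_fun s).
Proof.
move=> s1; have [C C0 hC] := gamma_fun_bound s1.
have h2 : (0 : R) < 2^-1 by rewrite invr_gt0.
have ie : mu.-integrable `[0, +oo[ (EFin \o (fun t => (2 * C) * exponential_pdf 2^-1 t)).
  rewrite (_ : _ \o _ = (fun t => (2 * C)%:E * (EFin \o exponential_pdf 2^-1) t)%E) //.
  apply: integrableZl => //.
  by apply: integrableS (integrable_exponential_pdf h2).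
apply: le_integrable ie => //.
- by apply/measurable_EFinP/measurable_funTS; exact: measurable_gamma_fun.
- move=> t; rewrite /= in_itv /= andbT => t0.
  rewrite lee_fin ger0_norm ?gamma_fun_ge0 // exponential_pdfE //.
  rewrite ger0_norm ?mulr_ge0 ?expR_ge0 ?(ltW C0) ?(ltW h2) //.
  rewrite (le_trans (hC _ t0)) // le_eqVlt; apply/orP; left; apply/eqP.
  by field.
Qed.

Lemma GammaE (s : R) : 1 <= s -> Gamma s = \int[mu]_(t in `[0, +oo[) gamma_fun s t.
Proof.
move=> s1; rewrite -Rintegral_itv_obnd_cbnd //.
apply: integrableS (integrable_gamma_fun s1) => //.
by move=> x; rewrite /= !in_itv /= !andbT; exact: ltW.
Qed.

Lemma cvg_gamma_fun_infty (s : R) : 1 <= s -> gamma_fun s t @[t --> +oo] --> (0:R).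
Proof.
move=> s1; have [C C0 hC] := gamma_fun_bound s1.
apply: (@squeeze_cvgr _ _ _ _ (cst 0) (fun t => C * expR (- 2^-1 * t))).
- near=> t; rewrite gamma_fun_ge0 /=; apply: hC; near: t.
  by apply: nbhs_pinfty_ge; exact: num_real.
- exact: cvg_cst.
- rewrite -[X in _ --> X](mulr0 C); apply: cvgMr.
  rewrite (_ : (fun x => _) = (fun z => expR (- z)) \o (fun z => 2^-1 * z)); last first.
    by apply/funext => x /=; rewrite mulNr.
  apply: (@cvg_comp _ _ _ _ _ _ (pinfty_nbhs R)); last exact: cvgr_expR.
  by apply: gt0_cvgMry => //; rewrite invr_gt0.
Unshelve. all: by end_near. Qed.

Lemma continuous_gamma_fun (s t : R) : 0 < t -> {for t, continuous (gamma_fun s)}.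
Proof.
move=> t0; apply: differentiable_continuous; apply/derivable1_diffP.
apply: derivableM => //.
by apply: derivable_powR; rewrite in_itv /= t0.
Qed.

(** The integrand at s + 1 is t ^ s * exp (- t), whose derivative is the integrand
    of s * Gamma s - Gamma (s + 1): this is the integration by parts behind the
    functional equation. *)
Lemma is_derive_gamma_fun (s t : R) : 0 < t ->
  is_derive t 1 (gamma_fun (s + 1)) (s * gamma_fun s t - gamma_fun (s + 1) t).
Proof.
move=> t0; rewrite /gamma_fun addrK.
have h1 := is_derive1_powR s t0.
apply: is_derive_eq.
rewrite /GRing.scale /=; ring.
Qed.

Lemma cvg_gamma_fun_at0 (s : R) : 1 <= s ->
  gamma_fun s t @[t --> 0^'+] --> gamma_fun s 0.
Proof.
rewrite le_eqVlt => /predU1P[<-|s1].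
  rewrite /gamma_fun subrr powRr0; under eq_fun do rewrite powRr0.
  apply: cvgM; first exact: cvg_cst.
  apply: cvg_at_right_filter; apply: continuous_comp; last exact: continuous_expR.
  exact: opp_continuous.
rewrite /gamma_fun powR0 ?subr_eq0 ?gt_eqF // mul0r -[X in _ --> X](mul0r (expR (- 0))).
apply: cvgM; first by apply: powR_cvg0; rewrite subr_gt0.
apply: cvg_at_right_filter; apply: continuous_comp; last exact: continuous_expR.
exact: opp_continuous.
Qed.

Lemma continuous_gamma_recurrence (s t : R) : 0 < t ->
  {for t, continuous (fun t => s * gamma_fun s t - gamma_fun (s + 1) t)}.
Proof.
move=> t0; apply: cvgB; last exact: continuous_gamma_fun.
by apply: cvgM; [exact: cvg_cst|exact: continuous_gamma_fun].
Qed.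

Lemma cvg_gamma_recurrence_at0 (s : R) : 1 <= s ->
  s * gamma_fun s t - gamma_fun (s + 1) t @[t --> 0^'+]
  --> s * gamma_fun s 0 - gamma_fun (s + 1) 0.
Proof.
move=> s1; apply: cvgB; last by apply: cvg_gamma_fun_at0; rewrite (le_trans s1) ?lerDl.
by apply: cvgM; [exact: cvg_cst|exact: cvg_gamma_fun_at0].
Qed.

Lemma gamma_fun0 (s : R) : 1 <= s -> gamma_fun (s + 1) 0 = 0.
Proof.
move=> s1; rewrite /gamma_fun addrK powR0 ?mul0r // gt_eqF //.
exact: lt_le_trans s1.
Qed.

Lemma gamma_funS (s t : R) : 0 < t -> gamma_fun (s + 1) t = t * gamma_fun s t.
Proof.
move=> t0; rewrite /gamma_fun addrK mulrA; congr (_ * _).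
have : t `^ (1 + (s - 1)) = t `^ 1 * t `^ (s - 1).
  by apply: powRD; rewrite (gt_eqF t0) implybT.
by rewrite powRr1 ?(ltW t0) // => <-; rewrite addrC subrK.
Qed.

(** The primitive of [is_derive_gamma_fun] vanishes at 0 and at infinity. Its
    derivative changes sign at s only, so the half-line is split there: beyond s
    the fundamental theorem requires an integrand of constant sign. *)
Lemma GammaS (s : R) : 1 <= s -> Gamma (s + 1) = s * Gamma s.
Proof.
move=> s1; have s0 : 0 < s by exact: lt_le_trans s1.
have s1' : 1 <= s + 1 by rewrite (le_trans s1) ?lerDl.
have is1 := integrable_gamma_fun s1; have is2 := integrable_gamma_fun s1'.
pose h t := s * gamma_fun s t - gamma_fun (s + 1) t.
have isZ : mu.-integrable `[0, +oo[ (EFin \o (fun t => s * gamma_fun s t)).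
  by rewrite (_ : _ \o _ = (fun t => s%:E * (EFin \o gamma_fun s) t)%E) //; exact: integrableZl.
have ih : mu.-integrable `[0, +oo[ (EFin \o h).
  rewrite (_ : _ \o _ = (EFin \o (fun t => (s * gamma_fun s t)%R)) \- (EFin \o gamma_fun (s + 1)))%E //.
  exact: integrableB.
apply/eqP; rewrite eq_sym -subr_eq0 !GammaE // -RintegralZl // -RintegralB //.
rewrite -/(h _) (_ : (fun _ => _) = h) //.
have mh : measurable_fun setT h.
  apply: measurable_funB; last exact: measurable_gamma_fun.
  by apply: measurable_funM => //; exact: measurable_gamma_fun.
have F' t : 0 < t -> (gamma_fun (s + 1))^`()%classic t = h t.
  by move=> t0; rewrite derive1E; have h' := is_derive_gamma_fun s t0; rewrite derive_val.
have dF t : 0 < t -> derivable (gamma_fun (s + 1)) t 1.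
  by move=> t0; have h' := is_derive_gamma_fun s t0; exact: ex_derive.
have first : (\int[mu]_(t in `[0%R, s]) (h t)%:E = (gamma_fun (s + 1) s)%:E)%E.
  rewrite (@continuous_FTC2 _ _ (gamma_fun (s + 1))) //.
  - by rewrite gamma_fun0 // sube0.
  - apply/continuous_within_itvP => //; split.
    + by move=> t; rewrite in_itv /= => /andP[t0 _]; exact: continuous_gamma_recurrence.
    + exact: cvg_gamma_recurrence_at0.
    + by apply: cvg_at_left_filter; exact: continuous_gamma_recurrence.
  - split.
    + by move=> t; rewrite in_itv /= => /andP[t0 _]; exact: dF.
    + exact: cvg_gamma_fun_at0.
    + by apply: cvg_at_left_filter; exact: continuous_gamma_fun.
  - by move=> t; rewrite in_itv /= => /andP[t0 _]; exact: F'.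
have second : (\int[mu]_(t in `[s, +oo[) (h t)%:E = - (gamma_fun (s + 1) s)%:E)%E.
  rewrite (@le0_continuous_FTC2y _ _ (gamma_fun (s + 1)) _ 0) //.
  - by rewrite sub0e.
  - move=> t st; rewrite /h gamma_funS ?(lt_le_trans s0) // -mulrBl.
    by rewrite mulr_le0_ge0 ?gamma_fun_ge0 // subr_le0.
  - apply/continuous_within_itvcyP; split.
    + move=> t; rewrite in_itv /= andbT => st; apply: continuous_gamma_recurrence.
      exact: lt_trans st.
    + by apply: cvg_at_right_filter; exact: continuous_gamma_recurrence.
  - exact: cvg_gamma_fun_infty.
  - by apply: cvg_at_right_filter; exact: continuous_gamma_fun.
  - by move=> t st; apply: dF; exact: lt_trans st.
  - by move=> t; rewrite in_itv /= andbT => st; apply: F'; exact: lt_trans st.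
rewrite /Rintegral (@itv_bndbnd_setU _ _ (BLeft 0) (BRight s) +oo%O) ?bnd_simp //; last exact: ltW.
rewrite integral_setU /=; last 4 first.
- exact: measurable_itv.
- exact: measurable_itv.
- by apply: measurable_funTS; exact/measurable_EFinP.
- apply/disj_setPS => y /= []; rewrite !in_itv /= => /andP[_ ys] /andP[].
  by rewrite ltNge ys.
rewrite integral_itv_obnd_cbnd; last by apply: measurable_funTS; exact/measurable_EFinP.
by rewrite [X in (X + _)%E]first [X in (_ + X)%E]second subee.
Qed.

Lemma Gamma1 : Gamma (1 : R) = 1.
Proof.
have g1 t : gamma_fun 1 t = expR (- t) by rewrite /gamma_fun subrr powRr0 mul1r.
rewrite GammaE // (@Rintegral_ge0_continuous_FTC2y _ _ (fun t => - expR (- t)) _ 0).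
- by rewrite oppr0 expR0 opprK add0r.
- by move=> t _; exact: gamma_fun_ge0.
- apply: continuous_subspaceT => t; rewrite (funext g1).
  apply: continuous_comp; last exact: continuous_expR.
  exact: opp_continuous.
- by rewrite -oppr0; apply: cvgN; exact: cvgr_expR.
- by move=> t _.
- apply: cvg_at_right_filter; apply: cvgN; apply: continuous_comp; last exact: continuous_expR.
  exact: opp_continuous.
- move=> t _; rewrite g1 derive1E.
  have -> : 'D_1 (fun t : R => - expR (- t)) t = expR (- t) by rewrite derive_val mulrN1 opprK.
  by [].
Qed.

Lemma Gamma_nat (n : nat) : Gamma (n%:R + 1 : R) = n`!%:R.
Proof.
elim: n => [|n IH]; first by rewrite add0r Gamma1.
have n1 : 1 <= n%:R + 1 :> R by rewrite lerDr.
by rewrite -natr1 GammaS // IH factS natrM natr1.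
Qed.

(** Concavity of u ^ a: its graph lies below the tangent at 1. *)
Lemma young_powR (u a : R) : 0 <= u -> 0 < a -> a <= 1 -> u `^ a <= a * u + (1 - a).
Proof.
move=> u0 a0; rewrite le_eqVlt => /predU1P[->|a1].
  by rewrite powRr1 // mul1r subrr addr0.
have a1' : 0 < 1 - a by rewrite subr_gt0.
have := @conjugate_powR R (u `^ a) 1 a^-1 (1 - a)^-1 (powR_ge0 _ _) ler01.
rewrite !invr_gt0 !invrK a0 a1' addrC subrK => /(_ erefl erefl erefl).
by rewrite mulr1 -powRrM divff ?gt_eqF // powRr1 // powR1 mul1r mulrC.
Qed.

(** Wendel's inequality: [young_powR] at u = t / x bounds t ^ a by
    x ^ a * (a * t / x + 1 - a), and the resulting integrals are Gamma x and
    Gamma (x + 1) = x * Gamma x. *)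
Lemma Gamma_wendel (x a : R) : 1 <= x -> 0 <= a -> a <= 1 ->
  Gamma (x + a) <= x `^ a * Gamma x.
Proof.
move=> x1; rewrite le_eqVlt => /predU1P[<- _|a0 a1].
  by rewrite addr0 powRr0 mul1r.
have x0 : 0 < x by exact: lt_le_trans x1.
have xa1 : 1 <= x + a by rewrite (le_trans x1) ?lerDl ?ltW.
have x1' : 1 <= x + 1 by rewrite lerDr ltW.
have i0 := integrable_gamma_fun x1; have i1 := integrable_gamma_fun x1'.
have iZ c s : mu.-integrable `[0, +oo[ (EFin \o gamma_fun s) ->
    mu.-integrable `[0, +oo[ (EFin \o (fun t => c * gamma_fun s t)).
  move=> h; rewrite (_ : _ \o _ = (fun t => c%:E * (EFin \o gamma_fun s) t)%E) //.
  exact: integrableZl.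
(* The two integrals produced by the tangent line at u = t / x. *)
have xE : x `^ a * Gamma x =
    x `^ a * (a / x) * Gamma (x + 1) + x `^ a * (1 - a) * Gamma x.
  rewrite GammaS //; field; exact: lt0r_neq0.
rewrite xE !GammaE // -!RintegralZl // -RintegralD //; try exact: iZ.
apply: le_Rintegral => //; first exact: integrable_gamma_fun.
  rewrite (_ : _ \o _ = (EFin \o (fun t => x `^ a * (a / x) * gamma_fun (x + 1) t)%R) \+
    (EFin \o (fun t => x `^ a * (1 - a) * gamma_fun x t)%R))%E //.
  by apply: integrableD => //; exact: iZ.
move=> t; rewrite /= in_itv /= andbT le_eqVlt => /predU1P[<-|t0].
  rewrite {1}/gamma_fun powR0 ?mul0r; last first.
    by rewrite addrAC gt_eqF // ltr_wpDl // subr_ge0.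
  have ax0 : 0 <= a / x by rewrite divr_ge0 // ltW.
  have a1' : 0 <= 1 - a by rewrite subr_ge0.
  by apply: addr_ge0; (apply: mulr_ge0; last exact: gamma_fun_ge0);
    (apply: mulr_ge0; first exact: powR_ge0).
rewrite gamma_funS // [leRHS](_ : _ = x `^ a * (a * (t / x) + (1 - a)) * gamma_fun x t); last ring.
have -> : gamma_fun (x + a) t = x `^ a * (t / x) `^ a * gamma_fun x t.
  rewrite -powRM ?divr_ge0 ?ltW // [x * _]mulrC divfK ?gt_eqF //.
  rewrite /gamma_fun mulrA; congr (_ * _).
  by rewrite addrAC addrC; apply: powRD; rewrite (gt_eqF t0) implybT.
rewrite ler_wpM2r ?gamma_fun_ge0 // ler_wpM2l ?powR_ge0 // young_powR //.
by rewrite divr_ge0 ?ltW.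
Qed.

(** Wendel's inequality from s to 2 bounds Gamma s below by a positive multiple of
    Gamma 2 = 1. *)
Lemma Gamma_gt0 (s : R) : 1 <= s -> s <= 2 -> 0 < Gamma s.
Proof.
move=> s1 s2; have s0 : 0 < s by exact: lt_le_trans s1.
have h : 1 <= s `^ (2 - s) * Gamma s.
  rewrite -[leLHS](Gamma_nat 1) (_ : 1%:R + 1 = s + (2 - s)); last ring.
  by apply: Gamma_wendel => //; lra.
have := lt_le_trans ltr01 h.
by rewrite pmulr_rgt0 // powR_gt0.
Qed.

Lemma Gamma_nat_shift (n : nat) (a : R) : 0 <= a ->
  Gamma (n%:R + 1 + a) = Gamma (1 + a) * \prod_(1 <= k < n.+1) (k%:R + a).
Proof.
move=> a0; elim: n => [|n IH]; first by rewrite add0r big_geq // mulr1.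
have n1 : 1 <= n%:R + 1 + a by rewrite -addrA addrCA lerDl addr_ge0.
rewrite -[n.+1%:R]natr1 (_ : n%:R + 1 + 1 + a = n%:R + 1 + a + 1); last ring.
rewrite GammaS // IH [in RHS]big_nat_recr //= -[n.+1%:R]natr1.
by set P := \prod_(_ <= _ < _) _; ring.
Qed.

(** Wendel's inequality from n + 1 to n + 1 + a bounds the quotient below by
    (n + 1) ^ (- a); from n + 1 + a to n + 2 it bounds it above by
    (n + 1 + a) ^ (1 - a) / (n + 1). *)
Lemma Gamma_ratio_bounds (n : nat) (a : R) : (0 < n)%N -> 0 < a -> a <= 1 ->
  1 - (n%:R + 1)^-1 <= n%:R `^ a * (Gamma (n%:R + 1) / Gamma (n%:R + 1 + a)) <= 1 + (n%:R + 1)^-1.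
Proof.
move=> n0 a0 a1; set x : R := n%:R + 1.
have n0' : 0 < n%:R :> R by rewrite ltr0n.
have x1 : 1 <= x by rewrite lerDr ltW.
have x0 : 0 < x by exact: lt_le_trans x1.
have xa1 : 1 <= x + a by rewrite (le_trans x1) // lerDl ltW.
have xa0 : 0 < x + a by exact: lt_le_trans xa1.
have Gx : 0 < Gamma x by rewrite /x Gamma_nat ltr0n fact_gt0.
have Gxa : 0 < Gamma (x + a).
  rewrite /x Gamma_nat_shift ?(ltW a0) // mulr_gt0 //.
    by apply: Gamma_gt0; lra.
  rewrite big_nat prodr_gt0 // => k _; rewrite ltr_wpDl //.
have up := Gamma_wendel x1 (ltW a0) a1.
have lo : Gamma (x + 1) <= (x + a) `^ (1 - a) * Gamma (x + a).
  rewrite (_ : x + 1 = x + a + (1 - a)); last ring.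
  by apply: Gamma_wendel; lra.
rewrite GammaS // in lo.
have P0 : 0 < n%:R `^ a by rewrite powR_gt0.
have xP0 : 0 < x `^ a by rewrite powR_gt0.
apply/andP; split.
  rewrite (@le_trans _ _ (n%:R `^ a * (x `^ a)^-1)) //.
    rewrite [leLHS](_ : _ = n%:R / x); last by rewrite /x; field; rewrite gt_eqF.
    rewrite -powRN -powR_inv1; last exact: ltW.
    rewrite [X in X * _ <= _](_ : _ = n%:R `^ a * n%:R `^ (1 - a)); last first.
      by rewrite -powRD ?(gt_eqF n0') ?implybT // addrC subrK powRr1 // ltW.
    rewrite [X in _ * X <= _](_ : _ = x `^ (- a) * x `^ (a - 1)); last first.
      rewrite -powRD ?(gt_eqF x0) ?implybT //; congr (_ `^ _); ring.
    rewrite mulrACA ler_piMr ?mulr_ge0 ?powR_ge0 //.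
    rewrite (_ : a - 1 = - (1 - a)); last ring.
    rewrite powRN ler_pdivrMr ?powR_gt0 // mul1r ge0_ler_powR ?nnegrE ?subr_ge0 ?(ltW x0) //.
    by rewrite lerDl.
  by rewrite ler_wpM2l ?(ltW P0) // ler_pdivlMr // mulrC ler_pdivrMr // mulrC.
have h1 : Gamma x / Gamma (x + a) <= (x + a) `^ (1 - a) / x.
  by rewrite ler_pdivrMr // mulrAC ler_pdivlMr // mulrC.
rewrite (@le_trans _ _ ((x + a) `^ a * ((x + a) `^ (1 - a) / x))) //.
  have nx : n%:R <= x + a by rewrite /x -addrA lerDl addr_ge0 // ltW.
  apply: ler_pM => //; first by apply: ltW; rewrite divr_gt0.
  by rewrite ge0_ler_powR ?nnegrE ?(ltW a0) ?(ltW xa0).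
rewrite mulrA -powRD ?(gt_eqF xa0) ?implybT // subrKC powRr1 ?(ltW xa0) //.
by rewrite mulrDl divff ?gt_eqF // lerD2l ler_piMl // invr_ge0 ltW.
Qed.

End GammaFunction.

(** * Comparison of minima over samples of different sizes *)
Section ExpectedMin.
Variables (R : realType) (r : R) (D : nat).
Hypotheses (r0 : 0 < r) (D0 : (0 < D)%N).
Local Notation e := (expected_min r D).

Let shift_gt0 (N : nat) : 0 < N.+1%:R + D%:R^-1 :> R.
Proof. by apply: ltr_wpDr; rewrite ?invr_ge0. Qed.

Lemma expected_minS (N : nat) : e N.+1 = e N * (N.+1%:R / (N.+1%:R + D%:R^-1)).
Proof. by rewrite /expected_min [in LHS]big_nat_recr //= -[RHS]mulrA. Qed.

Lemma expected_min_anti (N M : nat) : (N <= M)%N -> e M <= e N.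
Proof.
move=> /subnKC <-; elim: (M - N)%N => [|j IH]; first by rewrite addn0.
rewrite addnS expected_minS (le_trans _ IH) //.
apply: ler_piMr; first by rewrite ltW // expected_min_gt0.
by rewrite ler_pdivrMr // mul1r lerDl invr_ge0.
Qed.

(** Each factor (k + 1/D) / k lost by removing a sample is at most (k + 1) / k, and
    these bounds telescope. *)
Lemma expected_min_shift (N j : nat) :
  e N <= e (N + j)%N * ((N + j).+1%:R / N.+1%:R).
Proof.
elim: j => [|j IH]; first by rewrite addn0 divff ?mulr1 // pnatr_eq0.
apply: (le_trans IH); rewrite addnS expected_minS -[leRHS]mulrA.
apply: ler_wpM2l; first by rewrite ltW // expected_min_gt0.
rewrite mulrA; apply: ler_wpM2r; first by rewrite invr_ge0.
rewrite mulrAC ler_pdivlMr //; apply: ler_wpM2l => //.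
by rewrite -[leRHS]natr1 lerD2l invf_le1 ?ltr0n // ler1n.
Qed.

Lemma expected_min_Gamma (n : nat) :
  e n = r * Gamma (1 + D%:R^-1) * (Gamma (n%:R + 1) / Gamma (n%:R + 1 + D%:R^-1)).
Proof.
have a0 : (0 : R) <= D%:R^-1 by rewrite invr_ge0.
have a1 : (D%:R^-1 : R) <= 1 by rewrite invf_le1 ?ltr0n // ler1n.
have G0 : 0 < Gamma (1 + D%:R^-1 : R) by apply: Gamma_gt0; lra.
rewrite Gamma_nat Gamma_nat_shift // -mulrA; congr (r * _).
have -> : \prod_(1 <= k < n.+1) (k%:R / (k%:R + D%:R^-1)) =
    n`!%:R / \prod_(1 <= k < n.+1) (k%:R + D%:R^-1) :> R.
  rewrite fact_prod natr_prod big_split /=; congr (_ * _).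
  by rewrite (big_morph _ (@invfM _) (@invr1 _)).
have P0 : 0 < \prod_(1 <= k < n.+1) (k%:R + D%:R^-1) :> R.
  by rewrite big_nat prodr_gt0 // => -[|k] // _; exact: shift_gt0.
by field; rewrite !gt_eqF.
Qed.

End ExpectedMin.

(** * Finite sums of integrable variables *)
Section Expectation.
Context (R : realType) (d : measure_display) (T : measurableType d) (P : probability T R).

Lemma integrable_RZr (k : R) (X : T -> R) : P.-integrable setT (EFin \o X) ->
  P.-integrable setT (EFin \o (fun w => X w * k)).
Proof.
by move=> iX; rewrite (_ : _ \o _ = ((EFin \o X) \* cst k%:E)%E) //; exact: integrableZr.
Qed.

Lemma integrable_RZl (k : R) (X : T -> R) : P.-integrable setT (EFin \o X) ->
  P.-integrable setT (EFin \o (fun w => k * X w)).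
Proof.
by move=> iX; under eq_fun do rewrite mulrC; exact: integrable_RZr.
Qed.

Lemma integrable_Rsum (K : Type) (s : seq K) (p : pred K) (h : K -> T -> R) :
    (forall k, P.-integrable setT (EFin \o h k)) ->
  P.-integrable setT (EFin \o (fun w => \sum_(k <- s | p k) h k w)).
Proof.
move=> ih; rewrite (_ : _ \o _ = (fun w => \sum_(k <- s | p k) (EFin \o h k) w)%E).
  by apply: integrable_sum => // k _; exact: ih.
by apply/funext => w /=; rewrite sumEFin.
Qed.

Lemma Rintegral_sum (K : Type) (s : seq K) (p : pred K) (h : K -> T -> R) :
    (forall k, P.-integrable setT (EFin \o h k)) ->
  \int[P]_w (\sum_(k <- s | p k) h k w) = \sum_(k <- s | p k) \int[P]_w h k w.
Proof.
move=> ih; elim: s => [|k s IH].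
  by rewrite big_nil; under eq_Rintegral do rewrite big_nil; rewrite Rintegral_cst ?mul0r.
rewrite big_cons; under eq_Rintegral do rewrite big_cons.
case: ifP => // _; rewrite RintegralD // ?IH //; exact: integrable_Rsum.
Qed.

Lemma Rintegral_indicator (B : set T) : measurable B -> \int[P]_w \1_B w = fine (P B).
Proof. by move=> mB; rewrite /Rintegral integral_indic // setIT. Qed.

Lemma integrable_indicator (B : set T) : measurable B -> P.-integrable setT (EFin \o \1_B).
Proof.
by move=> mB; exact: integrable_indic.
Qed.

Lemma integrable_indicM (B : set T) (X : T -> R) : measurable B ->
  P.-integrable setT (EFin \o X) ->
  P.-integrable setT (EFin \o (fun w => \1_B w * X w)).
Proof.
move=> mB iX.
have -> : EFin \o (fun w => \1_B w * X w) = ((EFin \o \1_B) \* (EFin \o X))%E by [].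
apply: integrableMr => //.
exists 1; split=> // x x1 w _; rewrite /= ger0_norm //.
by apply: le_trans (ltW x1); rewrite indicE; case: (_ \in _).
Qed.

End Expectation.

(** * Variables determined by the order of the costs *)
Section OrderPattern.
Context (R : realType) (d : measure_display) (T : measurableType d) (J : finType).
Variable Y : J -> T -> R.
Hypothesis mY : forall j, measurable_fun setT (Y j).

Definition same_order (y z : J -> R) := forall j k, (y j <= y k) = (z j <= z k).

(** Greedy choices, sorted neighbor lists and optimal matchings only look at
    comparisons between finitely many variables. There are finitely many order
    patterns, so anything determined by the pattern is measurable. *)
Definition order_invariant (U : Type) (g : T -> U) :=
  forall w w', same_order (Y^~ w) (Y^~ w') -> g w = g w'.

Lemma measurable_order_pattern (p : {ffun J * J -> bool}) :
  measurable [set w | [ffun e => Y e.1 w <= Y e.2 w] = p].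
Proof.
rewrite (_ : [set _ | _] =
  \bigcap_(e in [set: J * J]) [set w | (Y e.1 w <= Y e.2 w) = p e]); last first.
  apply/seteqP; split=> [w <- e _|w h] /=; first by rewrite ffunE.
  by apply/ffunP => e; rewrite ffunE; exact: h.
apply: fin_bigcap_measurable => [|e _]; first exact: finite_finset.
have := @measurable_fun_ler _ T R setT _ _ (mY e.1) (mY e.2) measurableT [set p e].
by rewrite setTI; apply.
Qed.

Lemma measurable_order_event (Q : T -> Prop) :
  order_invariant Q -> measurable [set w | Q w].
Proof.
move=> invQ; pose pat w : {ffun J * J -> bool} := [ffun e => Y e.1 w <= Y e.2 w].
rewrite (_ : [set w | Q w] = \bigcup_(p in [set p | exists2 w, pat w = p & Q w])
    [set w | pat w = p]); last first.
  apply/seteqP; split=> [w Qw|w [p [w' <- Qw']] /= ww']; first by exists (pat w) => //; exists w.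
  rewrite (invQ w w') // => j k.
  by have /ffunP/(_ (j, k)) := ww'; rewrite !ffunE.
apply: fin_bigcup_measurable => [|p _]; first exact: finite_finset.
exact: measurable_order_pattern.
Qed.

Lemma measurable_order_fun (d' : measure_display) (U : measurableType d') (g : T -> U) :
  order_invariant g -> measurable_fun setT g.
Proof.
move=> invg _ A mA; rewrite setTI; apply: measurable_order_event => w w' ww'.
by rewrite /= (invg w w').
Qed.

Lemma order_invariant_comp (U V : Type) (k : U -> V) (g : T -> U) :
  order_invariant g -> order_invariant (k \o g).
Proof. by move=> invg w w' /invg /= ->. Qed.

(** A sum over a list that the order pattern selects is a finite sum of the
    variables with bounded measurable coefficients, namely multiplicities. *)
Lemma integrable_order_sum (mu : {measure set T -> \bar R}) (L : T -> seq J) (K : nat) :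
    (forall j, mu.-integrable setT (EFin \o Y j)) ->
    order_invariant L -> (forall w, size (L w) <= K)%N ->
  mu.-integrable setT (EFin \o (fun w => \sum_(j <- L w) Y j w)).
Proof.
move=> iY invL LK.
have -> : EFin \o (fun w => \sum_(j <- L w) Y j w) =
   (fun w => \sum_(j : J) ((EFin \o (fun w => (count_mem j (L w))%:R)) \* (EFin \o Y j)) w)%E.
  apply/funext => w /=; rewrite (eq_bigr (fun j => ((count_mem j (L w))%:R * Y j w)%:E)) //.
  rewrite sumEFin; congr EFin; elim: (L w) => [|j s IH].
    by rewrite big_nil big1 // => j _; rewrite mul0r.
  rewrite big_cons IH [RHS](eq_bigr (fun i => (j == i)%:R * Y i w + (count_mem i s)%:R * Y i w)); last first.
    by move=> i _; rewrite /= natrD mulrDl.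
  rewrite big_split /=; congr (_ + _).
  rewrite (bigD1 j) //= eqxx mul1r big1 ?addr0 // => i ij.
  by rewrite eq_sym (negbTE ij) mul0r.
apply: integrable_sum => // j _; apply: integrableMr => //.
  apply: measurable_order_fun; exact: (order_invariant_comp (fun s => (count_mem j s)%:R)).
exists K%:R; split; first exact: num_real.
move=> x Kx w _; rewrite /= ger0_norm // (le_trans _ (ltW Kx)) // ler_nat.
by rewrite (leq_trans (count_size _ _)).
Qed.

End OrderPattern.

Section PowerCdf.
Variables (R : realType) (r : R) (D : nat).
Hypothesis r0 : 0 < r.

Lemma measurable_power_cdf : measurable_fun setT (power_cdf r D).
Proof.
apply: measurable_fun_ifT => //; first exact: measurable_fun_ltr.
apply: measurable_fun_ifT => //; first exact: measurable_fun_ler.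
by apply: measurable_funX; exact: measurable_funM.
Qed.

Lemma power_cdf_le1 (x : R) : power_cdf r D x <= 1.
Proof.
rewrite /power_cdf; case: ltP => // x0; case: (leP x r) => // xr.
apply: exprn_ile1; first by rewrite divr_ge0 // ltW.
by rewrite ler_pdivrMr // mul1r.
Qed.

End PowerCdf.

(** * Independence between rows of costs *)
Section Costs.
Variables (R : realType) (r : R) (D m n : nat).
Hypotheses (r0 : 0 < r) (D0 : (0 < D)%N).
Variable I : rbmp (power_cdf r D) m n.
Local Notation T := (rbmp_space I).
Local Notation P := (rbmp_prob I).
Local Notation F := (power_cdf r D).
Definition cost (e : 'I_m * 'I_n) (w : T) : R := rbmp_cost I e w.

Lemma measurable_cost e : measurable_fun setT (cost e).
Proof. exact: measurable_funPT. Qed.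

Lemma cost_tail e x : P (cost e @^-1` `]x, +oo[) = (1 - F x)%:E.
Proof.
have := ccdf_1_cdf (rbmp_cost I e) x; rewrite rbmp_cdf -EFinB => <-.
by [].
Qed.

(** The CDF only controls costs almost surely: a cost may leave the interval
    from 0 to r on a null set. *)
Lemma cost_ae e : {ae P, forall w, 0 <= cost e w <= r}.
Proof.
have P1 : P (cost e @^-1` `]-oo, 0]) = 0%E.
  have := rbmp_cdf I e 0; rewrite /power_cdf ltxx ltW // mul0r expr0n gtn_eqF //=.
have P2 : P (cost e @^-1` `]r, +oo[) = 0%E.
  by rewrite cost_tail /power_cdf ltNge ltW //= lexx divff ?gt_eqF // expr1n subrr.
have N1 : P.-negligible (cost e @^-1` `]-oo, 0]).
  apply/negligibleP => //; rewrite -[X in measurable X]setTI.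
  by apply: measurable_cost => //; exact: measurable_itv.
have N2 : P.-negligible (cost e @^-1` `]r, +oo[).
  apply/negligibleP => //; rewrite -[X in measurable X]setTI.
  by apply: measurable_cost => //; exact: measurable_itv.
apply: negligibleS (negligibleU N1 N2) => w /= /negP.
rewrite negb_and -!ltNge !in_itv /= andbT => /orP[/ltW|] ?; [by left|by right].
Qed.

Lemma integrable_cost e : P.-integrable setT (EFin \o cost e).
Proof.
have mc := measurable_cost e.
apply/integrableP; split; first exact/measurable_EFinP.
apply: (@le_lt_trans _ _ (\int[P]_w (cst r%:E w))%E).
  apply: ae_ge0_le_integral => //.
  - by apply: measurableT_comp => //; exact/measurable_EFinP.
  - by move=> w _; rewrite lee_fin ltW.
  - have := cost_ae e; apply: filterS => w /andP[c0 cr] _ /=.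
    by rewrite lee_fin ger0_norm.
rewrite integral_cst // [X in (_ * X)%E](_ : _ = 1%E) ?mule1 ?ltry //.
exact: probability_setT.
Qed.

Lemma prob_rectangle (S : {set 'I_m * 'I_n}) (A : 'I_m * 'I_n -> set R) :
    (forall e, measurable (A e)) ->
  P [set w | forall e, e \in S -> A e (cost e w)] =
  (\prod_(e in S) P (cost e @^-1` A e))%E.
Proof. exact: rbmp_indep. Qed.

(** Finite rectangles in the rows of U: a pi-system generating the events that
    depend on these rows only. *)
Definition row_event (U : {set 'I_m}) (B : set T) :=
  exists (S : {set 'I_m * 'I_n}) (A : 'I_m * 'I_n -> set R),
    [/\ forall e, e \in S -> e.1 \in U, forall e, measurable (A e)
      & B = [set w | forall e, e \in S -> A e (cost e w)]].

Definition row_sigma (U : {set 'I_m}) : set (set T) := <<s row_event U >>.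

Lemma row_event_measurable U : row_event U `<=` measurable.
Proof.
move=> B [S [A [_ mA ->]]].
rewrite (_ : [set _ | _] = \bigcap_(e in [set` S]) (cost e @^-1` A e)) //.
apply: fin_bigcap_measurable => [|e _]; first exact: finite_finset.
by rewrite -[X in measurable X]setTI; exact: measurable_cost.
Qed.

Lemma row_sigma_measurable U B : row_sigma U B -> measurable B.
Proof.
apply: smallest_sub; last exact: row_event_measurable.
exact: sigma_algebra_measurable.
Qed.

Lemma row_event_setI U : setI_closed (row_event U).
Proof.
move=> _ _ [S1 [A1 [S1U mA1 ->]]] [S2 [A2 [S2U mA2 ->]]].
exists (S1 :|: S2)%SET, (fun e => (if e \in S1 then A1 e else setT) `&`
                              (if e \in S2 then A2 e else setT)); split.
- by move=> e; rewrite finset.in_setU => /orP[/S1U|/S2U].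
- by move=> e; apply: measurableI; case: ifP.
- apply/seteqP; split=> [w [h1 h2] e _|w h] /=.
    by split; case: ifP => // /[dup] ? ?; [exact: h1|exact: h2].
  split=> e eS; have := h e; rewrite finset.in_setU eS ?orbT => /(_ isT) [].
    by [].
  by [].
Qed.

Definition row_tail (u : 'I_m) (A : {set 'I_n}) (x : R) : set T :=
  [set w | forall v, v \in A -> x < cost (u, v) w].

Lemma row_tailE u A x : row_tail u A x =
  [set w | forall e, e \in [set (u, v) | v in A]%SET -> `]x, +oo[%classic (cost e w)].
Proof.
apply/seteqP; split=> [w h e /imsetP[v vA ->]|w h v vA] /=.
  by rewrite in_itv /= andbT h.
have := h (u, v); rewrite /= in_itv /= andbT; apply; exact: imset_f.
Qed.

Lemma measurable_row_tail u A x : measurable (row_tail u A x).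
Proof.
apply: (@row_event_measurable [set u]%SET); rewrite row_tailE.
exists [set (u, v) | v in A]%SET, (fun=> `]x, +oo[%classic); split=> //.
by move=> e /imsetP[v _ ->]; rewrite finset.in_set1.
Qed.

Lemma prob_row_tail u A x : P (row_tail u A x) = ((1 - F x) ^+ #|A|)%:E.
Proof.
rewrite row_tailE (@prob_rectangle _ (fun=> `]x, +oo[%classic)) //.
rewrite (eq_bigr (fun=> (1 - F x)%:E)); last by move=> e _; exact: cost_tail.
rewrite prodEFin prodr_const card_imset //.
by move=> v v' [].
Qed.

Lemma row_event_indep (U : {set 'I_m}) u (A : {set 'I_n}) x B : u \notin U -> row_event U B ->
  P (B `&` row_tail u A x) = (P B * P (row_tail u A x))%E.
Proof.
move=> uU [S [A' [SU mA' ->]]]; rewrite row_tailE.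
set S' := [set (u, v) | v in A]%SET.
have dS : fintype.disjoint (mem S) (mem S').
  apply/pred0P => e /=; apply/negP => /andP[/SU eU /imsetP[v _ E]].
  by move: eU; rewrite E /= (negbTE uU).
have hS' e : e \in S' -> (e \in S) = false.
  by move=> eS'; apply: contraTF eS' => eS; rewrite (disjointFr dS).
rewrite (_ : _ `&` _ = [set w | forall e, e \in (S :|: S')%SET ->
   (if e \in S then A' e else `]x, +oo[%classic) (cost e w)]); last first.
  apply/seteqP; split=> [w [h1 h2] e|w h] /=.
    by rewrite finset.in_setU; case: ifP => [eS _|_ /= eS]; [exact: h1|exact: h2].
  split=> e eS; have := h e; rewrite finset.in_setU eS ?orbT => /(_ isT) //.
  by rewrite hS'.
rewrite (@prob_rectangle _ (fun=> `]x, +oo[%classic)) // prob_rectangle //.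
rewrite (@prob_rectangle _ (fun e => if e \in S then A' e else `]x, +oo[%classic)); last first.
  by move=> e; case: ifP.
rewrite (eq_bigl [predU S & S']) => [|e]; last by rewrite finset.in_setU.
rewrite bigU //=; congr (_ * _)%E; apply: eq_bigr => e eS; rewrite ?eS //.
by rewrite hS'.
Qed.

(** As measures in B, both sides agree on the pi-system of rectangles, hence on the
    sigma-algebra that it generates. *)
Lemma row_sigma_indep (U : {set 'I_m}) u (A : {set 'I_n}) x B : u \notin U -> row_sigma U B ->
  P (B `&` row_tail u A x) = (P B * P (row_tail u A x))%E.
Proof.
move=> uU; have mE := measurable_row_tail u A x.
rewrite prob_row_tail.
have q0 : 0 <= (1 - F x) ^+ #|A|.
  by rewrite -lee_fin -(prob_row_tail u).
pose m1 := mrestr P mE; pose m2 := mscale (NngNum q0) P.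
have E : [set X | row_event U X /\ X `<=` setT] = row_event U.
  by apply/seteqP; split=> [X []|X].
move=> rB; rewrite muleC.
have := @g_sigma_algebra_measure_unique_trace _ _ _ (row_event U) setT measurableT
  _ _ m1 m2.
rewrite E; apply=> //.
- exact: row_event_measurable.
- exact: row_event_setI.
- change (P (setT `&` row_tail u A x) = ((1 - F x) ^+ #|A|)%:E * P setT)%E.
  by rewrite setTI prob_row_tail (_ : P setT = 1%E) ?mule1 //; exact: probability_setT.
- move=> X eX; change (P (X `&` row_tail u A x) = ((1 - F x) ^+ #|A|)%:E * P X)%E.
  by rewrite (row_event_indep A x uU eX) prob_row_tail muleC.
- change (P (setT `&` row_tail u A x) < +oo)%E.
  by rewrite setTI prob_row_tail ltry.
Qed.

Lemma row_sigmaS (U V : {set 'I_m}) : U \subset V -> row_sigma U `<=` row_sigma V.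
Proof.
move=> UV; apply: smallest_sub; first exact: smallest_sigma_algebra.
move=> B [S [A [SU mA ->]]]; apply: sub_sigma_algebra; exists S, A; split=> // e /SU.
exact: (fintype.subsetP UV).
Qed.

Lemma row_sigma_order_event (U : {set 'I_m}) u (Q : T -> Prop) : u \in U ->
  order_invariant (fun v => cost (u, v)) Q -> row_sigma U [set w | Q w].
Proof.
move=> uU invQ.
apply: (@measurable_order_event R _ (g_sigma_algebraType (row_event U)) _
  (fun v => cost (u, v))) => // v _ A mA.
rewrite setTI; apply: sub_sigma_algebra.
exists [set (u, v)]%SET, (fun=> A); split=> //; first by move=> e /finset.set1P ->.
apply/seteqP; split=> [w h e /finset.set1P -> //|w h] /=.
by apply: h; rewrite finset.in_set1.
Qed.

End Costs.

(** * The nearest free supply vertex and the greedy matching *)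
Section NearestFree.
Variables (R : realType) (m n : nat).
Implicit Types (c : 'I_m -> 'I_n -> R) (A : {set 'I_n}).

Lemma nearest_freeP c u A : (#|A| < n)%N ->
  exists v, [/\ nearest_free c u A = Some v, v \notin A
    & forall v', v' \notin A -> c u v <= c u v'].
Proof.
move=> An; rewrite /nearest_free; case: pickP => [v|none].
  rewrite finset.in_setC => /andP[vA /forallP h]; exists v; split=> // v' v'A.
  by have := h v'; rewrite finset.in_setC v'A.
have [v0 v0A] : exists v, v \in (~: A)%SET.
  by apply/finset.set0Pn; rewrite -card_gt0 cardsCs finset.setCK card_ord subn_gt0.
case: (@arg_minP _ _ _ v0 (mem (~: A)%SET) (c u) v0A) => v vA h.
have := none v; rewrite (vA : v \in (~: A)%SET) /=; move/negP; case; apply/forallP => v'.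
by apply/implyP; exact: h.
Qed.

Lemma eq_nearest_free c c' u A :
  same_order (c u) (c' u) -> nearest_free c u A = nearest_free c' u A.
Proof.
move=> cc'; rewrite /nearest_free; apply: eq_pick => v; congr (_ && _).
by apply: eq_forallb => v'; rewrite cc'.
Qed.

Definition free_cost c u A : R :=
  if nearest_free c u A is Some v then c u v else 0.

Lemma free_cost_le c u A v : v \notin A -> free_cost c u A <= c u v.
Proof.
move=> vA; have An : (#|A| < n)%N.
  rewrite -[X in (_ < X)%N](card_ord n) -cardsT; apply: proper_card.
  by rewrite properE finset.subsetT; apply: contra vA => /fintype.subsetP; apply.
by rewrite /free_cost; have [v' [-> _ h]] := nearest_freeP c u An; exact: h.
Qed.

Lemma gt_free_cost c u A x : (#|A| < n)%N ->
  x < free_cost c u A <-> forall v, v \in (~: A)%SET -> x < c u v.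
Proof.
move=> An; rewrite /free_cost; have [v [-> vA h]] := nearest_freeP c u An.
split=> [xv v'|]; last by apply; rewrite finset.in_setC.
by rewrite finset.in_setC => /h; exact: lt_le_trans.
Qed.

Definition greedy_total c s A : R := \sum_(x <- greedy_matching c s A) c x.1 x.2.

Lemma eq_greedy_matching c c' s A :
  (forall u, same_order (c u) (c' u)) -> greedy_matching c s A = greedy_matching c' s A.
Proof.
move=> cc'; elim: s A => //= u s IH A; rewrite (eq_nearest_free _ (cc' u)).
by case: nearest_free => [v|//]; rewrite IH.
Qed.

Lemma size_greedy_matching c s A : (size (greedy_matching c s A) <= size s)%N.
Proof. by elim: s A => //= u s IH A; case: nearest_free => [v|//]; exact: IH. Qed.

(** One step of the greedy algorithm, which is the recursion that the computation of
    the mean follows. *)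
Lemma greedy_total_cons c u s A v : nearest_free c u A = Some v ->
  greedy_total c (u :: s) A = free_cost c u A + greedy_total c s (v |: A)%SET.
Proof. by move=> fv; rewrite /greedy_total /free_cost /= fv big_cons. Qed.

End NearestFree.

(** * Mean cost of the greedy steps *)
Section Expectations.
Variables (R : realType) (r : R) (D m n : nat).
Hypotheses (r0 : 0 < r) (D0 : (0 < D)%N).
Variable I : rbmp (power_cdf r D) m n.
Local Notation T := (rbmp_space I).
Local Notation P := (rbmp_prob I).
Local Notation F := (power_cdf r D).
Local Notation cost := (@cost R r D m n I).
Local Notation e := (expected_min r D).

Lemma meanE X : mean I X = \int[P]_w X (edge_costs w).
Proof. by rewrite /mean unlock. Qed.

Lemma edge_same_order (w w' : T) u : same_order (cost^~ w) (cost^~ w') ->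
  same_order (edge_costs w u) (edge_costs w' u).
Proof. by move=> ww' v v'; have := ww' (u, v) (u, v'). Qed.

Lemma integrable_free_cost u A :
  P.-integrable setT (EFin \o (fun w => free_cost (edge_costs w) u A)).
Proof.
pose L (w : T) := if nearest_free (edge_costs w) u A is Some v then [:: (u, v)] else [::].
have -> : (fun w => free_cost (edge_costs w) u A) = (fun w => \sum_(j <- L w) cost j w).
  apply/funext => w; rewrite /free_cost /L; case: nearest_free => [v|].
    by rewrite big_seq1.
  by rewrite big_nil.
apply: (@integrable_order_sum _ _ _ _ _ _ _ _ 1).
- by move=> j; exact: measurable_cost.
- by move=> j; exact: integrable_cost.
- by move=> w w' /(edge_same_order u) /eq_nearest_free; rewrite /L => ->.
- by move=> w; rewrite /L; case: nearest_free.
Qed.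

(** The cost exceeds x exactly when all free costs of row u do, an event that is
    independent of B; the tail formula then reduces the mean to
    [integral_tail_pow]. The indicator of B makes room for the history of a greedy
    run. *)
Lemma mean_free_cost (U : {set 'I_m}) (B : set T) u (A : {set 'I_n}) :
    u \notin U -> row_sigma U B -> (#|A| < n)%N ->
  \int[P]_w (\1_B w * free_cost (edge_costs w) u A) = fine (P B) * e (n - #|A|).
Proof.
move=> uU sB An; have mB := row_sigma_measurable sB.
have iX := integrable_free_cost u A.
have mX : measurable_fun setT (fun w : T => free_cost (edge_costs w) u A).
  by apply/measurable_EFinP; exact: measurable_int iX.
(* A free cost may be negative on a null set; the tail formula needs a variable that is
   nonnegative everywhere. *)
pose z (w : T) := \1_B w * Num.max (free_cost (edge_costs w) u A) 0.
have mz : measurable_fun setT z.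
  by apply: measurable_funM => //; exact: measurable_maxr.
pose Z : {RV P >-> R} := HB.pack z (isMeasurableFun.Build _ _ _ _ z mz).
have Z0 w : 0 <= Z w by rewrite mulr_ge0 // le_max lexx orbT.
have cA : #|(~: A)%SET| = (n - #|A|)%N by rewrite cardsCs finset.setCK card_ord.
have EZ : ('E_P[Z] = P B * (e (n - #|A|))%:E)%E.
  rewrite ge0_expectation_ccdf // -(@integral_tail_pow _ r D) ?subn_gt0 //.
  rewrite -ge0_integralZl //=; last 2 first.
  - apply: measurable_funTS; apply/measurable_EFinP; apply: measurable_funX.
    by apply: measurable_funB => //; exact: measurable_power_cdf.
  - by move=> x _; rewrite lee_fin exprn_ge0 // subr_ge0 power_cdf_le1.
  apply: eq_integral => x; rewrite inE /= in_itv /= andbT => x0.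
  have -> : ccdf Z x = P (B `&` row_tail u (~: A)%SET x).
    rewrite /ccdf /distribution /pushforward; congr (P _).
    apply/seteqP; split => w /=; rewrite in_itv /= andbT /z indicE.
      have [|_] := boolP (w \in B); last by rewrite mul0r ltNge x0.
      rewrite inE mul1r => Bw; rewrite lt_max ltNge [x < 0]ltNge x0 orbF -ltNge.
      by move=> /(gt_free_cost _ _ _ An).
    move=> [Bw /(gt_free_cost (edge_costs w) u x An)]; rewrite mem_set // mul1r.
    by rewrite lt_max => ->.
  by rewrite (row_sigma_indep _ _ uU sB) prob_row_tail cA.
have eZ : (\int[P]_w (\1_B w * free_cost (edge_costs w) u A)%:E = 'E_P[Z])%E.
  rewrite expectation_def; apply: ae_eq_integral => //.
  - by apply/measurable_EFinP; exact: measurable_funM.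
  - exact/measurable_EFinP.
  - have h : {ae P, forall w : T, forall v : 'I_n, 0 <= edge_costs w u v}.
      apply: filter_forall => v.
      by have := cost_ae r0 D0 I (u, v); apply: filterS => w /andP[].
    apply: filterS h => w h _.
    rewrite /Z /= /z max_l // /free_cost.
    by case: nearest_free.
by rewrite /Rintegral eZ EZ fineM // fin_num_measure.
Qed.
Lemma integrable_greedy_total s A :
  P.-integrable setT (EFin \o (fun w : T => greedy_total (edge_costs w) s A)).
Proof.
have -> : (fun w : T => greedy_total (edge_costs w) s A) =
    (fun w => \sum_(x <- greedy_matching (edge_costs w) s A) cost x w).
  by apply/funext => w; apply: eq_bigr => -[].
apply: (@integrable_order_sum _ _ _ _ _ _ _ _ (size s)).
- by move=> j; exact: measurable_cost.
- by move=> j; exact: integrable_cost.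
- move=> w w' ww'; apply: eq_greedy_matching => u; exact: edge_same_order.
- by move=> w; exact: size_greedy_matching.
Qed.

Lemma row_sigma_setI (U : {set 'I_m}) (B C : set T) :
  row_sigma U B -> row_sigma U C -> row_sigma U (B `&` C).
Proof. exact: (@measurableI _ (g_sigma_algebraType (row_event U))). Qed.

(** Induction on the remaining demand vertices. The first step adds the identity of
    the matched supply vertex to the history B, and row u to the rows U on which the
    history depends; the mean of the remaining steps depends on the number of taken
    vertices only, so the probabilities of the possible histories add up to P B. *)
Lemma mean_greedy_total (U : {set 'I_m}) (B : set T) s (A : {set 'I_n}) :
    uniq s -> (forall u, u \in s -> u \notin U) -> row_sigma U B ->
    (#|A| + size s <= n)%N ->
  \int[P]_w (\1_B w * greedy_total (edge_costs w) s A)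
  = fine (P B) * \sum_(0 <= i < size s) e (n - #|A| - i).
Proof.
elim: s U B A => [|u s IH] U B A /=.
  move=> _ _ _ _; rewrite big_geq // mulr0; under eq_Rintegral do rewrite /greedy_total big_nil mulr0.
  by rewrite Rintegral_cst ?mul0r.
move=> /andP[us su] sU sB; rewrite addnS => An.
have uU : u \notin U by apply: sU; rewrite mem_head.
have An' : (#|A| < n)%N by apply: leq_trans An; rewrite ltnS leq_addr.
have mB := row_sigma_measurable sB.
pose E v : set T := [set w : T | nearest_free (edge_costs w) u A = Some v].
have sE v : row_sigma (u |: U)%SET (B `&` E v).
  apply: row_sigma_setI.
    by apply: row_sigmaS sB; exact: finset.subsetUr.
  apply: (@row_sigma_order_event _ _ _ _ _ _ _ u); first exact: finset.setU11.
  by move=> w w' ww'; rewrite /E (@eq_nearest_free _ _ _ _ (edge_costs w')).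
have mE v := row_sigma_measurable (sE v).
have indE (w : T) : \1_B w = \sum_(v in (~: A)%SET) \1_(B `&` E v) w :> R.
  have [v [fv vA _]] := nearest_freeP (edge_costs w) u An'.
  rewrite (bigD1 v) ?finset.in_setC //= big1 ?addr0 => [|v' /andP[_ v'v]].
    by rewrite !indicE in_setI (mem_set (fv : E v w)) andbT.
  rewrite indicE in_setI [w \in E v']memNset ?andbF // /E /= fv.
  by case=> vv'; rewrite vv' eqxx in v'v.
(* The cost of a run is the cost of its first step plus, on the event that this step takes v,
   the cost of the run that starts with v taken. *)
have split (w : T) : \1_B w * greedy_total (edge_costs w) (u :: s) A =
    \1_B w * free_cost (edge_costs w) u A +
    \sum_(v in (~: A)%SET) \1_(B `&` E v) w * greedy_total (edge_costs w) s (v |: A)%SET.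
  have [v [fv vA _]] := nearest_freeP (edge_costs w) u An'.
  rewrite (greedy_total_cons s fv) mulrDr; congr (_ + _).
  rewrite indE big_distrl /=; apply: eq_bigr => v' _.
  have [/set_mem[_]|nE] := boolP (w \in B `&` E v').
    by rewrite /E /= fv => -[->].
  by rewrite indicE (negbTE nE) !mul0r.
under eq_Rintegral do rewrite split.
rewrite RintegralD //; last 2 first.
- by apply: integrable_indicM => //; exact: integrable_free_cost.
- by apply: integrable_Rsum => v; apply: integrable_indicM => //; exact: integrable_greedy_total.
rewrite (mean_free_cost uU sB An') Rintegral_sum; last first.
  by move=> v; apply: integrable_indicM => //; exact: integrable_greedy_total.
rewrite big_nat_recl // subn0 mulrDr; congr (_ + _).
have -> : fine (P B) = \sum_(v in (~: A)%SET) fine (P (B `&` E v)).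
  rewrite -Rintegral_indicator //; under eq_Rintegral do rewrite indE.
  rewrite Rintegral_sum => [|v]; last exact: integrable_indicator.
  by apply: eq_bigr => v _; exact: Rintegral_indicator.
rewrite big_distrl /=; apply: eq_bigr => v; rewrite finset.in_setC => vA.
have cA : #|(v |: A)%SET| = #|A|.+1 by rewrite cardsU1 vA.
rewrite (IH (u |: U)%SET) //.
- by congr (_ * _); apply: eq_bigr => i _; rewrite cA -!subnDA addSnnS.
- move=> u' u's; rewrite finset.in_setU1 negb_or sU ?in_cons ?u's ?orbT // andbT.
  by apply: contraNneq us => <-.
- by rewrite cA addSn.
Qed.

End Expectations.

(** * Optimal and greedy matchings *)
Section Matchings.
Variables (R : realType) (m n : nat).
Implicit Types c : 'I_m -> 'I_n -> R.

(** A greedy run is a matching, so that its cost can be compared with the optimum.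
    The default v0 only gives the function a value outside s. *)
Lemma greedy_total_injection c (s : seq 'I_m) (A : {set 'I_n}) (v0 : 'I_n) :
    uniq s -> (#|A| + size s <= n)%N ->
  exists f : 'I_m -> 'I_n, [/\ {in s &, injective f}, forall u, u \in s -> f u \notin A
    & greedy_total c s A = \sum_(u <- s) c u (f u)].
Proof.
elim: s A => [|u s IH] A /=.
  by move=> _ _; exists (fun=> v0); split=> //; rewrite /greedy_total !big_nil.
rewrite addnS => /andP[us su] An.
have An' : (#|A| < n)%N by apply: leq_trans An; rewrite ltnS leq_addr.
have [v [fv vA _]] := nearest_freeP c u An'.
have [||f [finj fA ftot]] := IH (v |: A)%SET => //.
  by rewrite cardsU1 vA addSn.
have su' x : x \in s -> (x == u) = false.
  by move=> xs; apply: contraNF us => /eqP <-.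
have fv' x : x \in s -> f x != v /\ f x \notin A.
  by move=> /fA; rewrite finset.in_setU1 negb_or => /andP[].
exists (fun x => if x == u then v else f x); split.
- move=> x y; rewrite !in_cons.
  have [->|xu] := eqVneq x u; have [->|yu] := eqVneq y u => //=.
  + by move=> _ /fv'[/eqP fyv _] vfy; case: fyv.
  + by move=> /fv'[/eqP].
  + exact: finj.
- move=> x; rewrite in_cons; case: eqVneq => [//|_ /fv'[]//].
- rewrite (greedy_total_cons s fv) big_cons eqxx ftot; congr (_ + _).
    by rewrite /free_cost fv.
  by rewrite !big_seq; apply: eq_bigr => x /su' ->.
Qed.

Lemma optimal_costP c : (m <= n)%N ->
  exists s : {ffun 'I_m -> 'I_n}, [/\ [pick s | is_optimal c s] = Some s, injective s
    & forall t : {ffun 'I_m -> 'I_n}, injective t -> total_cost c s <= total_cost c t].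
Proof.
move=> mn; case: pickP => [s|none].
  case/andP => /injectiveP si /forallP h; exists s; split=> // t /injectiveP it.
  by have := h t; rewrite it.
pose t0 : {ffun 'I_m -> 'I_n} := [ffun u => widen_ord mn u].
have it0 : injectiveb t0.
  by apply/injectiveP => x y; rewrite !ffunE => /(congr1 val) /= /val_inj.
case: (@arg_minP _ _ _ t0 (fun t : {ffun 'I_m -> 'I_n} => injectiveb t) (total_cost c) it0) => s is_ h.
have := none s; rewrite /is_optimal is_ /= => /negP; case.
by apply/forallP => t; apply/implyP => it; exact: h.
Qed.

Lemma optimal_costE c : (m <= n)%N -> exists s : {ffun 'I_m -> 'I_n},
  [/\ optimal_cost c = total_cost c s / m%:R, injective s
    & forall t : {ffun 'I_m -> 'I_n}, injective t -> total_cost c s <= total_cost c t].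
Proof.
by move=> /(optimal_costP c)[s [ps si h]]; exists s; rewrite /optimal_cost ps.
Qed.

Lemma sum_free_cost_le_optimal c : (m <= n)%N ->
  (\sum_u free_cost c u finset.set0) / m%:R <= optimal_cost c.
Proof.
move=> /(optimal_costE c)[s [-> _ _]]; rewrite ler_wpM2r ?invr_ge0 //.
by apply: ler_sum => u _; apply: free_cost_le; rewrite finset.in_set0.
Qed.

Lemma greedy_costE c :
  greedy_cost c = (m`!)%:R^-1 *
    \sum_(pi : 'S_m) greedy_total c [seq pi u | u <- enum 'I_m] finset.set0 / m%:R.
Proof. by []. Qed.

Lemma optimal_le_greedy c : (0 < m)%N -> (m <= n)%N -> optimal_cost c <= greedy_cost c.
Proof.
move=> m_gt0 mn; have [s [-> si h]] := optimal_costE c mn.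
rewrite greedy_costE ler_pdivlMl ?ltr0n ?fact_gt0 // -[X in X%:R * _](card_Sn m).
rewrite -[X in X * _]sumr_const big_distrl /=.
rewrite (eq_bigl xpredT) //; apply: ler_sum => pi _; rewrite mul1r.
rewrite ler_wpM2r ?invr_ge0 //.
set sq := [seq _ | _ <- _].
have v0 : 'I_n by apply: (Ordinal (leq_trans m_gt0 mn)).
have usq : uniq sq by rewrite map_inj_uniq ?enum_uniq //; exact: perm_inj.
have memsq u : u \in sq.
  by rewrite -[u](permKV pi) map_f // mem_enum.
have [|f [finj _ ->]] := greedy_total_injection c (A := finset.set0) v0 usq.
  by rewrite cards0 size_map size_enum_ord.
have tE : \sum_(u <- sq) c u (f u) = total_cost c [ffun u => f u].
  rewrite /total_cost -[RHS]big_enum /=; under [RHS]eq_bigr do rewrite ffunE.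
  apply: perm_big; apply: uniq_perm => // [|u]; first exact: enum_uniq.
  by rewrite memsq mem_enum.
rewrite tE; apply: h => x y; rewrite !ffunE; exact: finj.
Qed.

End Matchings.

Section MeanMatchings.
Variables (R : realType) (r : R) (D m n : nat).
Hypotheses (r0 : 0 < r) (D0 : (0 < D)%N) (m0 : (0 < m)%N) (mn : (m <= n)%N).
Variable I : rbmp (power_cdf r D) m n.
Local Notation T := (rbmp_space I).
Local Notation P := (rbmp_prob I).
Local Notation cost := (@cost R r D m n I).
Local Notation e := (expected_min r D).

Let prob_setT : fine (P setT) = 1.
Proof. by rewrite (_ : P setT = 1%E) //; exact: probability_setT. Qed.

Let row_sigma_setT : row_sigma finset.set0 (setT : set T).
Proof. exact: (@measurableT _ (g_sigma_algebraType (row_event finset.set0))). Qed.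

Lemma mean_total s (A : {set 'I_n}) : uniq s -> (#|A| + size s <= n)%N ->
  \int[P]_w greedy_total (edge_costs w) s A = \sum_(0 <= i < size s) e (n - #|A| - i).
Proof.
move=> us An; rewrite -[RHS]mul1r -prob_setT.
rewrite -(mean_greedy_total r0 D0 us _ row_sigma_setT An) => [|u _]; last by rewrite finset.in_set0.
by apply: eq_Rintegral => w _; rewrite indicT mul1r.
Qed.

Lemma mean_free u (A : {set 'I_n}) : (#|A| < n)%N ->
  \int[P]_w free_cost (edge_costs w) u A = e (n - #|A|).
Proof.
move=> An; rewrite -[RHS]mul1r -prob_setT.
rewrite -(mean_free_cost r0 D0 (u := u) _ row_sigma_setT An); last by rewrite finset.in_set0.
by apply: eq_Rintegral => w _; rewrite indicT mul1r.
Qed.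

Lemma integrable_greedy : P.-integrable setT (EFin \o (fun w : T => greedy_cost (edge_costs w))).
Proof.
under eq_fun do rewrite greedy_costE mulrC.
apply: integrable_RZr; apply: integrable_Rsum => pi; apply: integrable_RZr.
exact: integrable_greedy_total.
Qed.

Lemma mean_greedyE : mean_greedy I = m%:R^-1 * \sum_(0 <= i < m) e (n - i).
Proof.
rewrite /mean_greedy meanE; under eq_Rintegral do rewrite greedy_costE.
rewrite RintegralZl //; last first.
  by apply: integrable_Rsum => pi; apply: integrable_RZr; exact: integrable_greedy_total.
rewrite Rintegral_sum; last first.
  by move=> pi; apply: integrable_RZr; exact: integrable_greedy_total.
rewrite (eq_bigr (fun=> m%:R^-1 * \sum_(0 <= i < m) e (n - i))) => [|pi _].
  have cS : #|{: 'S_m}| = m`! by rewrite -[RHS]card_Sn.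
  by rewrite sumr_const cS -[(_ * _) *+ _]mulr_natl mulKf //.
rewrite RintegralZr //; last exact: integrable_greedy_total.
rewrite mean_total; last 2 first.
- by rewrite map_inj_uniq ?enum_uniq //; exact: perm_inj.
- by rewrite cards0 size_map size_enum_ord.
by rewrite cards0 subn0 size_map size_enum_ord mulrC.
Qed.

(** An optimal matching is determined by the order of the total costs of all maps, so
    [integrable_order_sum] applies to the family of total costs. *)
Lemma integrable_optimal : P.-integrable setT (EFin \o (fun w : T => optimal_cost (edge_costs w))).
Proof.
pose L (w : T) := if [pick s | is_optimal (edge_costs w) s] is Some s then [:: s] else [::].
have -> : (fun w : T => optimal_cost (edge_costs w)) =
    (fun w => (\sum_(s <- L w) total_cost (edge_costs w) s) * m%:R^-1).
  apply/funext => w; rewrite /optimal_cost /L; case: pickP => [s _|_].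
    by rewrite big_seq1.
  by rewrite big_nil mul0r.
have iY (s : {ffun 'I_m -> 'I_n}) :
    P.-integrable setT (EFin \o (fun w : T => total_cost (edge_costs w) s)).
  by apply: integrable_Rsum => u; exact: (integrable_cost r0 D0 I (u, s u)).
apply: integrable_RZr.
apply: (@integrable_order_sum _ _ _ _ (fun s (w : T) => total_cost (edge_costs w) s) _ _ L 1).
- by move=> s; have /integrableP[/measurable_EFinP] := iY s.
- exact: iY.
- move=> w w' ww'; rewrite /L; rewrite (_ : [pick s | is_optimal (edge_costs w) s] =
    [pick s | is_optimal (edge_costs w') s]) //.
  apply: eq_pick => s; rewrite /is_optimal; congr (_ && _).
  by apply: eq_forallb => t; congr (_ ==> _); exact: ww'.
- by move=> w; rewrite /L; case: pickP.
Qed.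

Lemma mean_optimal_ge : e n <= mean_optimal I.
Proof.
rewrite /mean_optimal meanE.
have iS : P.-integrable setT (EFin \o (fun w : T => \sum_u free_cost (edge_costs w) u finset.set0)).
  by apply: integrable_Rsum => u; exact: integrable_free_cost.
have -> : e n = \int[P]_w ((\sum_u free_cost (edge_costs w) u finset.set0) / m%:R).
  rewrite RintegralZr // Rintegral_sum => [|u]; last exact: integrable_free_cost.
  rewrite (eq_bigr (fun=> e n)) => [|u _].
    by rewrite sumr_const card_ord -[X in X / _]mulr_natr mulfK // pnatr_eq0 -lt0n.
  by rewrite mean_free cards0 ?subn0 // (leq_trans m0).
apply: le_Rintegral => //; first exact: integrable_RZr.
  exact: integrable_optimal.
by move=> w _; exact: sum_free_cost_le_optimal.
Qed.

Lemma mean_optimal_le : mean_optimal I <= mean_greedy I.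
Proof.
rewrite /mean_optimal /mean_greedy !meanE; apply: le_Rintegral => //.
- exact: integrable_optimal.
- exact: integrable_greedy.
- by move=> w _; exact: optimal_le_greedy.
Qed.

(** At most m - 1 supply vertices are taken when a demand vertex is processed. *)
Lemma mean_greedy_le : mean_greedy I <= e (n - m.-1).
Proof.
rewrite mean_greedyE ler_pdivrMl ?ltr0n //.
apply: (@le_trans _ _ (\sum_(0 <= i < m) e (n - m.-1))).
  rewrite !big_nat; apply: ler_sum => i /andP[_ im]; apply: expected_min_anti => //.
  by apply: leq_sub2l; rewrite -ltnS prednK.
by rewrite sumr_const_nat subn0 mulr_natl.
Qed.

End MeanMatchings.

(** * Averaging the neighbor costs over the free sets *)

Lemma hockey_stick (n i : nat) : (i <= n)%N ->
  (\sum_(0 <= k < i.+1) 'C(n - k, i - k) = 'C(n.+1, i))%N.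
Proof.
elim: i n => [|i IH] n; first by rewrite big_nat1 !bin0.
case: n => // n; rewrite ltnS => /IH h.
rewrite big_nat_recl // !subn0 [in RHS]binS; congr (_ + _)%N.
  by rewrite -h; apply: eq_bigr => k _; rewrite !subSS.
Qed.

Section NeighborCosts.
Variables (R : realType) (m n : nat).
Implicit Types c : 'I_m -> 'I_n -> R.

Definition neighbors c u : seq 'I_n := sort (relpre (c u) <=%R) (enum 'I_n).

Lemma size_neighbors c u : size (neighbors c u) = n.
Proof. by rewrite size_sort size_enum_ord. Qed.

Lemma uniq_neighbors c u : uniq (neighbors c u).
Proof. by rewrite sort_uniq enum_uniq. Qed.

Lemma mem_neighbors c u v : v \in neighbors c u.
Proof. by rewrite mem_sort mem_enum. Qed.

Lemma eq_neighbors c c' u : same_order (c u) (c' u) -> neighbors c u = neighbors c' u.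
Proof.
move=> cc'; rewrite /neighbors; congr (sort _ _).
by apply/funext => v; apply/funext => v'; exact: cc'.
Qed.

Lemma neighbor_costE c u v0 k : (k < n)%N ->
  neighbor_cost c u k.+1 = c u (nth v0 (neighbors c u) k).
Proof.
by move=> kn; rewrite /neighbor_cost sort_map (nth_map v0) // size_neighbors.
Qed.

Lemma le_neighbor_cost c u j k : (0 < j)%N -> (j <= k)%N -> (k <= n)%N ->
  neighbor_cost c u j <= neighbor_cost c u k.
Proof.
move=> j0 jk kn; rewrite /neighbor_cost.
have szE : size (sort <=%R [seq c u v | v <- enum 'I_n]) = n.
  by rewrite size_sort size_map size_enum_ord.
apply: (sorted_leq_nth le_trans lexx).
- by apply: sort_sorted; exact: le_total.
- by rewrite inE szE (leq_trans _ kn) // (leq_trans _ jk) // prednK.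
- by rewrite inE szE (leq_trans _ kn) // prednK // (leq_trans j0).
- by rewrite -ltnS !prednK // (leq_trans j0).
Qed.

(** v is the nearest free vertex along the sorted list of neighbors of u, ties being
    broken by the list rather than by [nearest_free]. This makes the sets A that lead
    to v easy to count. *)
Definition first_free c u (A : {set 'I_n}) (v : 'I_n) : bool :=
  (v \notin A) && [forall v', (index v' (neighbors c u) < index v (neighbors c u))%N ==> (v' \in A)].

(** Such a set A consists of the j vertices nearer than v and of a - j vertices
    farther than v, where j is the rank of v counted from 0. *)
Lemma card_first_free c u v a : (index v (neighbors c u) <= a)%N ->
  #|[set A : {set 'I_n} | (#|A| == a) && first_free c u A v]%SET|
  = 'C(n - (index v (neighbors c u)).+1, a - index v (neighbors c u)).
Proof.
set s := neighbors c u; set j := index v s => ja.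
have card_lt k : (k <= n)%N -> #|[set v' | (index v' s < k)%N]%SET| = k.
  move=> kn; transitivity #|[set v' in take k s]%SET|.
    by apply: eq_card => v'; rewrite !finset.inE in_take ?mem_neighbors.
  rewrite cardsE; have /card_uniqP -> : uniq (take k s) by rewrite take_uniq // uniq_neighbors.
  by rewrite size_takel // size_neighbors.
have jn : (j < n)%N by rewrite -[n in X in (_ < X)%N](size_neighbors c u) index_mem mem_neighbors.
set Tj := [set v' | (index v' s < j)%N]%SET.
set Dj := [set v' | (j < index v' s)%N]%SET.
have cT : #|Tj| = j by apply: card_lt; exact: ltnW.
have cD : #|Dj| = (n - j.+1)%N.
  rewrite cardsCs card_ord -[in RHS](card_lt j.+1 jn); congr (n - _)%N.
  by apply: eq_card => v'; rewrite !finset.inE -leqNgt ltnS.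
have inT v' : (v' \in Tj) = (index v' s < j)%N by rewrite finset.inE.
have inD v' : (v' \in Dj) = (j < index v' s)%N by rewrite finset.inE.
(* Adding Tj is a bijection from the (a - j)-subsets of Dj to the sets that are counted. *)
rewrite -cD -cards_draws -(card_in_imset (f := fun B => B :|: Tj)%SET); last first.
  move=> B B'; rewrite !finset.inE => /andP[/fintype.subsetP BD _] /andP[/fintype.subsetP B'D _] /setP BB'.
  apply/setP => v'; have := BB' v'; rewrite !finset.in_setU inT.
  case: ltnP => [v'j _|_]; last by rewrite !orbF.
  by apply/idP/idP => [/BD|/B'D]; rewrite inD ltnNge ltnW.
apply: eq_card => A; rewrite finset.inE; apply/idP/imsetP.
  case/andP => /eqP cA /andP[vA /forallP TA].
  have sTA : (Tj \subset A)%SET.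
    by apply/fintype.subsetP => v'; rewrite inT => v'j; have := TA v'; rewrite v'j.
  exists (A :\: Tj)%SET; last first.
    by rewrite -[LHS](finset.setID A Tj) (finset.setIidPr sTA) finset.setUC.
  rewrite !finset.inE; apply/andP; split.
    apply/fintype.subsetP => v'; rewrite finset.in_setD inT inD -leqNgt => /andP[jv' v'A].
    rewrite ltn_neqAle jv' andbT; apply: contraNneq vA => jE.
    by rewrite -[v](nth_index v (mem_neighbors c u v)) -/s -/j jE nth_index // mem_neighbors.
  by rewrite cardsD (finset.setIidPr sTA) cA cT.
case=> B; rewrite !finset.inE => /andP[/fintype.subsetP BD /eqP cB] ->.
have dBT : (B :&: Tj = finset.set0)%SET.
  apply/setP => v'; rewrite finset.in_setI finset.in_set0 inT; apply/negP => /andP[/BD].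
  by rewrite inD ltnNge => /negP jv' /ltnW.
rewrite cardsU dBT cards0 subn0 cB cT subnK // eqxx /=; apply/andP; split.
  rewrite finset.in_setU inT ltnn orbF; apply/negP => /BD.
  by rewrite inD ltnn.
by apply/forallP => v'; apply/implyP => v'j; rewrite finset.in_setU inT v'j orbT.
Qed.

Lemma free_cost_first_free c u (A : {set 'I_n}) : (#|A| < n)%N ->
  exists v, [/\ first_free c u A v, (index v (neighbors c u) <= #|A|)%N
    , (forall v', first_free c u A v' -> v' = v) & free_cost c u A = c u v].
Proof.
move=> An; set s := neighbors c u.
have [w [fw wA wmin]] := nearest_freeP c u An.
case: (@arg_minnP _ w (fun v => v \notin A) (index^~ s) wA) => v vA vmin.
have ffv : first_free c u A v.
  rewrite /first_free vA; apply/forallP => v'; apply/implyP => v'v.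
  by apply: contraLR v'v => /vmin; rewrite -leqNgt.
exists v; split=> //.
- rewrite -[X in (X <= _)%N](size_takel (s := s)); last first.
    by rewrite size_neighbors ltnW // -[n in X in (_ < X)%N](size_neighbors c u) index_mem mem_neighbors.
  have /card_uniqP <- : uniq (take (index v s) s) by rewrite take_uniq // uniq_neighbors.
  apply: subset_leq_card; apply/fintype.subsetP => v' v's.
  have /andP[_ /forallP/(_ v')/implyP] := ffv; apply.
  by rewrite -in_take ?mem_neighbors.
- move=> v' /andP[v'A /forallP h].
  have iE : index v' s = index v s.
    apply/eqP; rewrite eqn_leq (vmin _ v'A) andbT leqNgt; apply/negP => vv'.
    by have := h v; rewrite vv' (negbTE vA).
  by rewrite -[v'](nth_index v (mem_neighbors c u v')) -/s iE nth_index // mem_neighbors.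
- rewrite /free_cost fw; apply/eqP; rewrite eq_le wmin //=.
  have tr : transitive (relpre (c u) <=%R) by move=> ? ? ?; exact: le_trans.
  have re : reflexive (relpre (c u) <=%R) by move=> ?; exact: lexx.
  have so : sorted (relpre (c u) <=%R) s by apply: sort_sorted => ? ?; exact: le_total.
  have := sorted_leq_nth tr re v so (index v s) (index w s).
  by rewrite !inE !index_mem !nth_index ?mem_neighbors // => /(_ isT isT (vmin w wA)).
Qed.

(** Group the sets A of size i - 1 according to the rank k of the nearest vertex that
    they leave free: by [card_first_free] there are 'C(n - k, i - k) of them. *)
Lemma sum_free_cost c u (i : nat) : (0 < i)%N -> (i <= n)%N ->
  \sum_(A : {set 'I_n} | #|A| == i.-1) free_cost c u A =
  \sum_(1 <= k < i.+1) 'C(n - k, i - k)%:R * neighbor_cost c u k.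
Proof.
case: i => // a _ an /=; set s := neighbors c u.
transitivity (\sum_(A : {set 'I_n} | #|A| == a)
   \sum_(v | (index v s <= a)%N) (first_free c u A v)%:R * c u v).
  apply: eq_bigr => A /eqP cA.
  have [|v [ffv va vuniq ->]] := @free_cost_first_free c u A; first by rewrite cA.
  rewrite (bigD1 v) /=; last by rewrite -cA.
  rewrite ffv mul1r big1 ?addr0 // => v' /andP[_ v'v].
  case: (boolP (first_free c u A v')) => [/vuniq E|_]; last by rewrite mul0r.
  by rewrite E eqxx in v'v.
rewrite exchange_big /=.
transitivity (\sum_(v | (index v s <= a)%N)
    'C(n - (index v s).+1, a - index v s)%:R * c u v).
  apply: eq_bigr => v va; rewrite -big_distrl /=; congr (_ * _).
  rewrite -(card_first_free va) -sum1_card natr_sum big_mkcond /= [RHS]big_mkcond /=.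
  apply: eq_bigr => A _; rewrite finset.inE.
  by case: (_ == _) => //=; case: first_free.
have v0 : 'I_n by exact: (Ordinal an).
have -> : \sum_(v | (index v s <= a)%N) 'C(n - (index v s).+1, a - index v s)%:R * c u v
    = \sum_(v <- s | (index v s <= a)%N) 'C(n - (index v s).+1, a - index v s)%:R * c u v.
  rewrite [RHS](perm_big (enum 'I_n)) /=; last by rewrite perm_sort.
  by rewrite big_enum_cond.
rewrite (big_nth v0) size_neighbors big_add1 /= (big_nat_widen _ _ _ _ _ an).
rewrite big_nat_cond [RHS]big_nat_cond; apply: eq_big => k.
  case kn : (k < n)%N => //=; rewrite index_uniq ?size_neighbors //; exact: uniq_neighbors.
case/andP => kn _; rewrite index_uniq ?size_neighbors //; last exact: uniq_neighbors.
by rewrite (neighbor_costE _ _ v0).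
Qed.

End NeighborCosts.

Section MeanNeighbor.
Variables (R : realType) (r : R) (D m n : nat).
Hypotheses (r0 : 0 < r) (D0 : (0 < D)%N) (m0 : (0 < m)%N).
Variable I : rbmp (power_cdf r D) m n.
Local Notation T := (rbmp_space I).
Local Notation P := (rbmp_prob I).
Local Notation cost := (@cost R r D m n I).
Local Notation e := (expected_min r D).

Lemma integrable_neighbor_cost u k :
  P.-integrable setT (EFin \o (fun w : T => neighbor_cost (edge_costs w) u k)).
Proof.
have [kn|nk] := ltnP k.-1 n; last first.
  rewrite (_ : _ \o _ = cst 0%E); first exact: integrable0.
  apply/funext => w; rewrite /= /neighbor_cost nth_default //.
  by rewrite size_sort size_map size_enum_ord.
have v0 : 'I_n by exact: (Ordinal kn).
pose L (w : T) := [:: (u, nth v0 (neighbors (edge_costs w) u) k.-1)].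
have -> : (fun w : T => neighbor_cost (edge_costs w) u k) =
    (fun w => \sum_(x <- L w) cost x w).
  by apply/funext => w; rewrite big_seq1; exact: (neighbor_costE (edge_costs w) u v0 kn).
apply: (@integrable_order_sum _ _ _ _ cost _ _ L 1).
- by move=> j; exact: measurable_cost.
- by move=> j; exact: integrable_cost.
- by move=> w w' /(edge_same_order u) /eq_neighbors; rewrite /L => ->.
- by [].
Qed.

Lemma mean_neighborE k :
  mean_neighbor I k = (\sum_u \int[P]_w neighbor_cost (edge_costs w) u k) / m%:R.
Proof.
rewrite /mean_neighbor meanE /sampled_neighbor_cost.
have ik u := integrable_neighbor_cost u k.
rewrite RintegralZr //; last exact: integrable_Rsum.
by rewrite Rintegral_sum.
Qed.

Lemma mean_neighbor_le j k : (0 < j)%N -> (j <= k)%N -> (k <= n)%N ->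
  mean_neighbor I j <= mean_neighbor I k.
Proof.
move=> j0 jk kn; rewrite !mean_neighborE.
rewrite ler_wpM2r ?invr_ge0 //; apply: ler_sum => u _; apply: le_Rintegral => //.
- exact: integrable_neighbor_cost.
- exact: integrable_neighbor_cost.
- by move=> w _; exact: le_neighbor_cost.
Qed.

(** The expectation of [sum_free_cost]; it avoids the distributions of the individual
    order statistics. *)
Lemma sum_mean_neighbor i : (0 < i)%N -> (i <= n)%N ->
  \sum_(1 <= k < i.+1) 'C(n - k, i - k)%:R * mean_neighbor I k
  = 'C(n, i.-1)%:R * e (n - i.-1).
Proof.
move=> i0 iN.
have per_u u : \sum_(1 <= k < i.+1) 'C(n - k, i - k)%:R *
      (\int[P]_w neighbor_cost (edge_costs w) u k) = 'C(n, i.-1)%:R * e (n - i.-1).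
  transitivity (\int[P]_w \sum_(1 <= k < i.+1)
      'C(n - k, i - k)%:R * neighbor_cost (edge_costs w) u k).
    rewrite Rintegral_sum => [|k]; last first.
      by apply: integrable_RZl; exact: integrable_neighbor_cost.
    by apply: eq_bigr => k _; rewrite RintegralZl //; exact: integrable_neighbor_cost.
  under eq_Rintegral do rewrite -sum_free_cost //.
  rewrite Rintegral_sum => [|A]; last exact: integrable_free_cost.
  rewrite (eq_bigr (fun=> e (n - i.-1))) => [|A /eqP cA].
    rewrite (eq_bigl (mem [set A : {set 'I_n} | #|A| == i.-1]%SET)) => [|A].
      by rewrite sumr_const card_draws card_ord mulr_natl.
    by rewrite /= finset.inE.
  by rewrite mean_free // cA // prednK.
under eq_bigr do rewrite mean_neighborE mulrA big_distrr /=.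
rewrite -big_distrl /= exchange_big /=.
rewrite (eq_bigr (fun=> 'C(n, i.-1)%:R * e (n - i.-1))) => [|u _]; last exact: per_u.
by rewrite sumr_const card_ord -[X in X / _]mulr_natr mulfK // pnatr_eq0 -lt0n.
Qed.

(** The case i = 1 of [sum_mean_neighbor]: the first neighbor realizes the
    minimum. *)
Lemma mean_neighbor1 : (0 < n)%N -> mean_neighbor I 1 = e n.
Proof.
move=> n0; have := sum_mean_neighbor (ltn0Sn 0) n0.
by rewrite big_nat1 !bin0 !mul1r subn0.
Qed.

End MeanNeighbor.

(** * Probabilities of comparing spacings *)
Section ProbLe.
Variables (R : realType) (d : measure_display) (T : measurableType d) (P : probability T R).
Local Notation mu := (@lebesgue_measure R).

Lemma integral_density (X : T -> R) (f : R -> R) : is_density P X f ->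
  (\int[mu]_x (f x)%:E = 1)%E.
Proof. by case=> mf f0 h; rewrite -h // preimage_setT; exact: probability_setT. Qed.

Lemma density_integral_le1 (X : T -> R) (f : R -> R) (A : set R) : measurable A ->
  is_density P X f -> (\int[mu]_(x in A) (f x)%:E <= 1)%E.
Proof.
move=> mA fX; rewrite -(integral_density fX); case: fX => mf f0 h.
apply: ge0_subset_integral => //; first exact/measurable_EFinP.
by move=> x _; rewrite lee_fin.
Qed.

Lemma density_integral_fin_num (X : T -> R) (f : R -> R) (A : set R) : measurable A ->
  is_density P X f -> (\int[mu]_(x in A) (f x)%:E)%E \is a fin_num.
Proof.
move=> mA fX; rewrite ge0_fin_numE.
  by rewrite (le_lt_trans (density_integral_le1 mA fX)) // ltry.
by case: fX => mf f0 h; apply: integral_ge0 => x _; rewrite lee_fin.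
Qed.

Lemma prob_le_bounds (X Y : T -> R) (f g : R -> R) :
  is_density P X f -> is_density P Y g -> 0 <= prob_le f g <= 1.
Proof.
move=> fX gY; have [mf f0 hf] := fX; have [mg g0 hg] := gY.
pose G y := \int[mu]_(x in `[0, y]) f x.
have G0 y : 0 <= G y by apply: Rintegral_ge0.
have G1 y : G y <= 1.
  rewrite -[leRHS]/(fine 1%E) fine_le //; first exact: (density_integral_fin_num _ fX).
  exact: (density_integral_le1 _ fX).
have mG : measurable_fun setT G.
  apply: nondecreasing_measurable => //. move=> x y xy.
  apply: fine_le; try exact: (density_integral_fin_num _ fX).
  apply: ge0_subset_integral => //.
  - by apply: measurable_funTS; exact/measurable_EFinP.
  - by move=> z _; rewrite lee_fin.
  - by move=> z /=; rewrite !in_itv /= => /andP[-> /le_trans]; apply.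
have le1 : (\int[mu]_(y in `[0%R, +oo[) (G y * g y)%:E <= 1)%E.
  apply: le_trans (density_integral_le1 (measurable_itv `[0%R, +oo[) gY).
  apply: ge0_le_integral => //.
  - by move=> y _; rewrite lee_fin mulr_ge0.
  - by apply/measurable_EFinP/measurable_funTS; exact: measurable_funM.
  - by apply/measurable_EFinP/measurable_funTS.
  - by move=> y _; rewrite lee_fin ler_piMl.
have ge0 : (0 <= \int[mu]_(y in `[0%R, +oo[) (G y * g y)%:E)%E.
  by apply: integral_ge0 => y _; rewrite lee_fin mulr_ge0.
rewrite /prob_le -/(G _); apply/andP; split; first exact: fine_ge0.
rewrite -[leRHS]/(fine 1%E) fine_le // ge0_fin_numE //.
by rewrite (le_lt_trans le1) // ltry.
Qed.

End ProbLe.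

(** * The refined cost *)
Section Triangular.
Variable R : numDomainType.

Lemma exchange_triangle (F : nat -> nat -> R) (m : nat) :
  \sum_(1 <= k < m.+1) \sum_(k <= i < m.+1) F k i
  = \sum_(1 <= i < m.+1) \sum_(1 <= k < i.+1) F k i.
Proof.
elim: m => [|m IH]; first by rewrite !big_geq.
rewrite [RHS]big_nat_recr //= -IH [X in _ = _ + X]big_nat_recr //= addrA.
rewrite [LHS]big_nat_recr //= big_nat1 -big_split /=; congr (_ + _).
rewrite !big_nat; apply: eq_bigr => k /andP[_ km].
by rewrite [LHS]big_nat_recr //= ltnW.
Qed.

(** s k times the product is the probability that the first success among
    independent trials of probabilities s j occurs at the k-th one. *)
Lemma sum_first_success (s : nat -> R) (N : nat) :
  \sum_(1 <= k < N.+1) s k * \prod_(1 <= j < k) (1 - s j)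
  = 1 - \prod_(1 <= j < N.+1) (1 - s j).
Proof.
elim: N => [|N IH]; first by rewrite !big_geq // subrr.
by rewrite big_nat_recr //= IH [in RHS]big_nat_recr //=; ring.
Qed.

End Triangular.

Section RefinedBounds.
Variables (R : realType) (m n : nat) (f : nat -> nat -> R -> R).
Hypotheses (m0 : (0 < m)%N) (mn : (m <= n)%N).
Hypothesis f01 : forall i j i' j', (0 < i)%N -> (i < j)%N -> (j <= n)%N ->
  (0 < i')%N -> (i' < j')%N -> (j' <= n)%N ->
  0 <= prob_le (f i j) (f i' j') <= 1.

(** The hockey stick identity: the weights of the possible second choices q' of the
    displaced vertex add up to 1. *)
Lemma sum_binom_shift (q : nat) : (q < m)%N ->
  (\sum_(q.+1 <= q' < m.+1) 'C(n - q', m - q') = 'C(n - q, m - q - 1))%N.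
Proof.
move=> qm; rewrite -{1}[q.+1]add0n big_addn subSS.
have [k kE] : exists k, (m - q = k.+1)%N by exists (m - q).-1; rewrite prednK // subn_gt0.
rewrite kE subn1 /= .
have nE : (n - q = (n - q.+1).+1)%N by rewrite subnSK // (leq_trans qm).
rewrite nE -hockey_stick; last by lia.
by apply: eq_bigr => i _; congr 'C(_, _); lia.
Qed.

Lemma swap_prob_bounds (k' k'' i : nat) : (0 < k'')%N -> (k'' <= k')%N ->
  (k' <= i)%N -> (i <= m)%N -> 0 <= swap_prob m n f k' k'' i <= 1.
Proof.
move=> k0 kk ki im; rewrite /swap_prob; case: eqVneq => [_|kN]; first by rewrite ler01 lexx.
have klt : (k'' < k')%N by rewrite ltn_neqAle kN.
have i1 : (1 < i)%N by rewrite (leq_trans _ ki) // (leq_ltn_trans k0).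
pose t q'' := \sum_(q''.+1 <= q' < m.+1) 'C(n - q', m - q')%:R / 'C(n - q'', m - q'' - 1)%:R
      * prob_le (f q'' q') (f k'' k').
have t01 q : (0 < q)%N -> (q < i)%N -> 0 <= t q <= 1.
  move=> q0 qi; have qm : (q < m)%N by exact: leq_trans im.
  have pb q' : (q < q' < m.+1)%N -> 0 <= prob_le (f q q') (f k'' k') <= 1.
    move=> /andP[qq' q'm]; apply: f01 => //; first exact: leq_trans mn.
    by rewrite (leq_trans ki) // (leq_trans im).
  have B0 : 0 < 'C(n - q, m - q - 1)%:R :> R.
    by rewrite ltr0n bin_gt0; lia.
  apply/andP; split; rewrite /t big_nat.
    apply: sumr_ge0 => q' /pb /andP[p0 _].
    by apply: mulr_ge0 => //; apply: divr_ge0.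
  apply: (@le_trans _ _ (\sum_(q.+1 <= q' < m.+1) 'C(n - q', m - q')%:R / 'C(n - q, m - q - 1)%:R)).
    rewrite [leRHS]big_nat; apply: ler_sum => q' /pb /andP[_ p1].
    by rewrite ler_piMr // divr_ge0.
  by rewrite -big_distrl /= -natr_sum sum_binom_shift // divff // gt_eqF.
have i0 : 0 < (i.-1)%:R :> R by rewrite ltr0n -subn1 subn_gt0.
apply/andP; split.
  apply: mulr_ge0; first by rewrite invr_ge0.
  by rewrite big_nat; apply: sumr_ge0 => q /andP[q0 qi]; case/andP: (t01 q q0 qi).
rewrite ler_pdivrMl // mulr1.
apply: (@le_trans _ _ (\sum_(1 <= q < i) 1)).
  by rewrite !big_nat; apply: ler_sum => q /andP[q0 qi]; case/andP: (t01 q q0 qi).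
by rewrite sumr_const_nat subn1.
Qed.

(** The probability that the i-th greedy step uses the k-th nearest neighbor. *)
Definition greedy_rank_prob (i k : nat) : R := 'C(n - k, i - k)%:R / 'C(n, i - 1)%:R.

(** The probability that a vertex initially matched to its k'-th nearest neighbor
    moves to its k-th one. *)
Definition swapped_rank_prob (i k' k : nat) : R :=
  swap_prob m n f k' k i * \prod_(1 <= j < k) (1 - swap_prob m n f k' j i).

Lemma sum_greedy_rank_prob i : (0 < i)%N -> (i <= n)%N -> \sum_(1 <= k < i.+1) greedy_rank_prob i k = 1.
Proof.
move=> i0 iN; rewrite -big_distrl /= -natr_sum.
have -> : (\sum_(1 <= k < i.+1) 'C(n - k, i - k) = 'C(n, i - 1))%N.
  rewrite big_add1 /=; case: i i0 iN => // i _ iN.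
  have nE : n = n.-1.+1 by lia.
  rewrite {2}nE subn1 -hockey_stick; last by lia.
  by apply: eq_bigr => k _; congr 'C(_, _); lia.
by rewrite divff // pnatr_eq0 -lt0n bin_gt0; lia.
Qed.

Lemma swapped_rank_prob_ge0 i k' k : (0 < k)%N -> (k <= k')%N -> (k' <= i)%N -> (i <= m)%N ->
  0 <= swapped_rank_prob i k' k.
Proof.
move=> k0 kk ki im; apply: mulr_ge0.
  by have /andP[] := swap_prob_bounds k0 kk ki im.
rewrite big_nat; apply: prodr_ge0 => j /andP[j0 jk].
by rewrite subr_ge0; have /andP[] := swap_prob_bounds j0 (ltnW (leq_trans jk kk)) ki im.
Qed.

(** The trial at rank k' always succeeds, as s(k', k' | i) = 1, so a first success
    exists. *)
Lemma sum_swapped_rank_prob i k' : (0 < k')%N -> \sum_(1 <= k < k'.+1) swapped_rank_prob i k' k = 1.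
Proof.
move=> k0; rewrite sum_first_success [in X in _ - X]big_nat_recr //=.
by rewrite [in X in _ - (_ * X)]/swap_prob eqxx subrr mulr0 subr0.
Qed.

Lemma refined_sumE (M : nat -> R) :
  \sum_(1 <= k < m.+1) M k * refined_prob m n f k =
  m%:R^-1 * \sum_(1 <= i < m.+1) \sum_(1 <= k' < i.+1)
    greedy_rank_prob i k' * \sum_(1 <= k < k'.+1) M k * swapped_rank_prob i k' k.
Proof.
rewrite /refined_prob; under eq_bigr do rewrite mulrCA big_distrr /=.
rewrite -big_distrr /=; congr (_ * _).
rewrite exchange_triangle; apply: eq_bigr => i _.
transitivity (\sum_(1 <= k < i.+1) \sum_(k <= k' < i.+1) greedy_rank_prob i k' * (M k * swapped_rank_prob i k' k)).
  apply: eq_bigr => k _; rewrite big_distrr /=; apply: eq_bigr => k' _.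
  by rewrite -mulrA mulrCA.
by rewrite exchange_triangle; apply: eq_bigr => k' _; rewrite big_distrr.
Qed.

Lemma refined_sum_ge (M : nat -> R) (b : R) :
    (forall k, (0 < k)%N -> (k <= n)%N -> b <= M k) ->
  b <= \sum_(1 <= k < m.+1) M k * refined_prob m n f k.
Proof.
move=> Mb; rewrite refined_sumE ler_pdivlMl ?ltr0n //.
apply: (@le_trans _ _ (\sum_(1 <= i < m.+1) b)).
  by rewrite sumr_const_nat subSS subn0 mulr_natl.
rewrite !big_nat; apply: ler_sum => i /andP[i0]; rewrite ltnS => im.
rewrite -[leLHS]mul1r -(sum_greedy_rank_prob i0 (leq_trans im mn)) big_distrl /=.
rewrite !big_nat; apply: ler_sum => k' /andP[k0]; rewrite ltnS => ki.
apply: ler_wpM2l; first exact: divr_ge0.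
rewrite -[leLHS]mulr1 -(sum_swapped_rank_prob i k0) big_distrr /=.
rewrite !big_nat; apply: ler_sum => k /andP[kk0]; rewrite ltnS => kk.
apply: ler_wpM2r; first exact: swapped_rank_prob_ge0.
by apply: Mb => //; rewrite (leq_trans kk) // (leq_trans ki) // (leq_trans im).
Qed.

(** A swap never moves a vertex to a higher rank, and M increases with the rank. *)
Lemma refined_sum_le (M : nat -> R) :
    (forall j k, (0 < j)%N -> (j <= k)%N -> (k <= n)%N -> M j <= M k) ->
  \sum_(1 <= k < m.+1) M k * refined_prob m n f k <=
  m%:R^-1 * \sum_(1 <= i < m.+1) \sum_(1 <= k < i.+1) greedy_rank_prob i k * M k.
Proof.
move=> Mle; rewrite refined_sumE ler_wpM2l ?invr_ge0 //.
rewrite !big_nat; apply: ler_sum => i /andP[i0]; rewrite ltnS => im.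
rewrite !big_nat; apply: ler_sum => k' /andP[k0]; rewrite ltnS => ki.
apply: ler_wpM2l; first exact: divr_ge0.
rewrite -[leRHS]mulr1 -(sum_swapped_rank_prob i k0) big_distrr /=.
rewrite !big_nat; apply: ler_sum => k /andP[kk0]; rewrite ltnS => kk.
apply: ler_wpM2r; first exact: swapped_rank_prob_ge0.
by apply: Mle => //; rewrite (leq_trans ki) // (leq_trans im).
Qed.

End RefinedBounds.

(** * Convergence *)
Section Final.
Variables (R : realType) (r : R) (D : nat).
Hypotheses (r0 : 0 < r) (D0 : (0 < D)%N).
Local Notation e := (expected_min r D).

Section Refined.
Variables (m n : nat) (I : rbmp (power_cdf r D) m n) (f : nat -> nat -> R -> R).
Hypotheses (m0 : (0 < m)%N) (mn : (m <= n)%N).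
Hypothesis f_density : forall (u : 'I_m) (i j : nat),
  (0 < i)%N -> (i < j)%N -> (j <= n)%N ->
  is_density (rbmp_prob I) (fun w => spacing (edge_costs w) u i j) (f i j).

Let f01 i j i' j' : (0 < i)%N -> (i < j)%N -> (j <= n)%N ->
  (0 < i')%N -> (i' < j')%N -> (j' <= n)%N ->
  0 <= prob_le (f i j) (f i' j') <= 1.
Proof.
move=> i0 ij jn i'0 ij' jn'; pose u := Ordinal m0.
exact: prob_le_bounds (f_density u i0 ij jn) (f_density u i'0 ij' jn').
Qed.

Lemma mean_refined_ge : e n <= mean_refined I f.
Proof.
apply: refined_sum_ge => // k k0 kn.
by rewrite -(mean_neighbor1 r0 D0 m0 I) ?mean_neighbor_le // (leq_trans m0).
Qed.

(** By [sum_mean_neighbor], the bound of [refined_sum_le] is the exact mean of the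
    greedy cost. *)
Lemma mean_refined_le : mean_refined I f <= mean_greedy I.
Proof.
apply: (le_trans (refined_sum_le m0 mn f01 (M := mean_neighbor I) _)).
  by move=> j k j0 jk kn; exact: mean_neighbor_le.
rewrite mean_greedyE // ler_wpM2l ?invr_ge0 // [leLHS]big_add1 /= !big_nat.
apply: ler_sum => i /andP[_ im].
under eq_bigr do rewrite mulrAC.
have iN : (i.+1 <= n)%N by exact: leq_trans mn.
rewrite -big_distrl /= sum_mean_neighbor // subn1 /= mulrAC divff ?mul1r //.
by rewrite pnatr_eq0 -lt0n bin_gt0 ltnW.
Qed.

End Refined.

(** The window that contains all the mean costs of the statement. *)
Definition nearly_nearest (X : nat * nat -> R) := forall p, (0 < p.1)%N ->
  (p.1 <= p.2)%N -> e p.2 <= X p <= e (p.2 - p.1.-1).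

(** By [expected_min_shift] the relative width of the window is at most
    (m - 1) / (n - m + 2), which is at most 1 / K once n >= (K + 1) * m. *)
Lemma cvg_nearly_nearest (X Y : nat * nat -> R) :
  nearly_nearest X -> nearly_nearest Y -> X p / Y p @[p --> much_greater] --> (1 : R).
Proof.
move=> hX hY; apply/cvgrPdist_le => eps eps0.
(* K > 1 / eps; the ratio K + 1 in the filter base leaves n - m + 2 >= K * m. *)
pose K := (Num.truncn eps^-1).+1.
have Keps : 1 <= eps * K%:R.
  rewrite mulrC -ler_pdivrMr // mul1r ltW //; exact: truncnS_gt.
exists K.+1 => // -[m n] /= [m0 Kmn].
have mn : (m <= n)%N by apply: leq_trans Kmn; rewrite leq_pmull.
have /andP[X1 X2] := hX (m, n) m0 mn; have /andP[Y1 Y2] := hY (m, n) m0 mn.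
move: X1 X2 Y1 Y2 => /=; set x := X _; set y := Y _ => X1 X2 Y1 Y2.
have e0 : 0 < e n by exact: expected_min_gt0.
have y0 : 0 < y by exact: lt_le_trans Y1.
have := expected_min_shift r0 D0 (n - m.-1) m.-1.
rewrite subnK; last by rewrite (leq_trans _ mn) // leq_pred.
set N := (n - m.-1)%N => hN.
have nE : n.+1%:R = N.+1%:R + m%:R - 1 :> R.
  have -> : n.+1 = (N.+1 + m.-1)%N by rewrite /N; lia.
  by rewrite natrD -subn1 natrB // addrA.
have mle : m%:R - 1 <= eps * N.+1%:R.
  have KN : K%:R * m%:R <= N.+1%:R :> R.
    by rewrite -natrM ler_nat /N; move: Kmn; rewrite mulSn; lia.
  apply: (@le_trans _ _ m%:R); first by rewrite lerBlDr lerDl.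
  apply: (@le_trans _ _ (eps * (K%:R * m%:R))).
    by rewrite mulrA ler_peMl.
  by rewrite ler_pM2l.
have eNle : e N - e n <= eps * e n.
  rewrite lerBlDr; apply: (le_trans hN).
  rewrite nE mulrA ler_pdivrMr ?ltr0n //.
  have := ler_wpM2l (ltW e0) mle; lra.
rewrite -[1](divff (lt0r_neq0 y0)) -mulrBl normrM [`|y^-1|]gtr0_norm ?invr_gt0 //.
rewrite ler_pdivrMr //.
have epsy : eps * e n <= eps * y by rewrite ler_pM2l.
rewrite ler_norml; apply/andP; split; lra.
Qed.

(** Wendel's bounds on the quotient of Gamma values, read on the closed form. *)
Lemma cvg_expected_min :
  expected_min r D n / (r * Gamma (1 + D%:R^-1) * n%:R `^ (- D%:R^-1))
    @[n --> \oo] --> (1 : R).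
Proof.
have a0 : (0 : R) < D%:R^-1 by rewrite invr_gt0 ltr0n.
have a1 : (D%:R^-1 : R) <= 1 by rewrite invf_le1 ?ltr0n // ler1n.
have G0 : 0 < Gamma (1 + D%:R^-1 : R) by apply: Gamma_gt0; lra.
have H : (n.+1%:R : R)^-1 @[n --> \oo] --> (0 : R) by exact: cvg_harmonic.
apply: (@squeeze_cvgr _ _ _ _ (fun n => 1 - n.+1%:R^-1) (fun n => 1 + n.+1%:R^-1)).
- exists 1%N => // n /= n0; have n0' : 0 < n%:R :> R by rewrite ltr0n.
  have := Gamma_ratio_bounds n0 a0 a1.
  have P0 : 0 < n%:R `^ D%:R^-1 :> R by rewrite powR_gt0.
  rewrite expected_min_Gamma // powRN -[n.+1%:R]natr1; set g := Gamma _ / _.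
  rewrite (_ : r * _ * g / _ = n%:R `^ D%:R^-1 * g) //.
  by field; rewrite !gt_eqF.
- by rewrite -[X in _ --> X]subr0; apply: cvgB => //; exact: cvg_cst.
- by rewrite -[X in _ --> X]addr0; apply: cvgD => //; exact: cvg_cst.
Qed.

End Final.

Theorem proposition4 (R : realType) (r : R) (D : nat)
    (r_gt0 : 0 < r) (D_gt0 : (0 < D)%N)
    (I : forall m n : nat, rbmp (power_cdf r D) m n)
    (f : nat -> nat -> nat -> R -> R)
    (f_density : forall (m n : nat) (u : 'I_m) (i j : nat),
       (0 < i)%N -> (i < j)%N -> (j <= n)%N ->
       is_density (rbmp_prob (I m n))
         (fun w => spacing (edge_costs w) u i j) (f n i j)) :
  let greedy (p : nat * nat) := mean_greedy (I p.1 p.2) in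
  let refined (p : nat * nat) := mean_refined (I p.1 p.2) (f p.2) in
  let optimal (p : nat * nat) := mean_optimal (I p.1 p.2) in
  let nearest (n : nat) := mean_greedy (I 1%N n) in
  [/\ greedy p / refined p @[p --> much_greater] --> (1 : R),
      refined p / optimal p @[p --> much_greater] --> (1 : R),
      optimal p / nearest p.2 @[p --> much_greater] --> (1 : R),
      (forall n : nat, (0 < n)%N ->
         nearest n = r * Gamma (1 + D%:R^-1)
                       * (Gamma (n%:R + 1) / Gamma (n%:R + 1 + D%:R^-1)))
    & nearest n / (r * Gamma (1 + D%:R^-1) * n%:R `^ (- D%:R^-1))
        @[n --> \oo] --> (1 : R)].
Proof.
move=> greedy refined optimal nearest.
have nearestE n : (0 < n)%N -> nearest n = expected_min r D n.
  by move=> n0; rewrite /nearest mean_greedyE // big_nat1 subn0 invr1 mul1r.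
have ho : nearly_nearest r D optimal.
  move=> -[m n] /= m0 mn; rewrite mean_optimal_ge //=.
  by apply: le_trans (mean_greedy_le _ _ _ _ _) => //; exact: mean_optimal_le.
have hg : nearly_nearest r D greedy.
  move=> -[m n] /= m0 mn; rewrite mean_greedy_le // andbT.
  by apply: le_trans (mean_optimal_le _ _ _ _ _) => //; exact: mean_optimal_ge.
have hr : nearly_nearest r D refined.
  move=> -[m n] /= m0 mn; apply/andP; split.
    by apply: mean_refined_ge => // u; exact: f_density.
  apply: le_trans (mean_greedy_le _ _ _ _ _) => //.
  by apply: mean_refined_le => // u; exact: f_density.
have hn : nearly_nearest r D (fun p => nearest p.2).
  move=> -[m n] /= m0 mn; rewrite nearestE ?(leq_trans m0) // lexx /=.
  by apply: expected_min_anti => //; exact: leq_subr.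
split.
- exact: cvg_nearly_nearest hg hr.
- exact: cvg_nearly_nearest hr ho.
- exact: cvg_nearly_nearest ho hn.
- by move=> n n0; rewrite nearestE // expected_min_Gamma.
- apply: cvg_trans (cvg_expected_min r_gt0 D_gt0).
  apply: near_eq_cvg; exists 1%N => // n /= n0.
  by rewrite nearestE.
Qed.
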